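(* Let $H\in(1/2,1]$ and $\rho\in(1,2]$ satisfy $\theta:=H-\frac1{2\rho}>\frac12$. Then for all $\beta>0$, $$\mathbb E\Big[\exp\Big(\beta\int_0^1\int_0^1|r-s|^{2H-2}\,\delta(X_r-X_s)\,dr\,ds\Big)\Big]<\infty.$$
   Context: $X=\{X_t,t\ge0\}$ is the symmetric $\rho$-stable Lévy process on $\mathbb R$ with $X_0=0$ and $\mathbb E[e^{\imath\eta X_t}]=e^{-c_\rho t|\eta|^\rho}$, $c_\rho>0$. The weighted self-intersection local time is defined by $$\int_0^1\int_0^1|r-s|^{2H-2}\delta(X_r-X_s)\,dr\,ds:=\lim_{\varepsilon\to0}\int_0^1\int_0^1|r-s|^{2H-2}p_\varepsilon(X_r-X_s)\,dr\,ds,$$ the limit being taken in $L^2$, where $p_\varepsilon(x)=\frac1{\sqrt{2\pi\varepsilon}}e^{-x^2/(2\varepsilon)}$. *)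

(* Defs.v *)
From HB Require Import structures.
From mathcomp Require Import all_boot all_order all_algebra.
From mathcomp Require Import all_classical all_reals all_analysis.
From mathcomp.real_closed Require Import complex.

Set Implicit Arguments.
Unset Strict Implicit.
Unset Printing Implicit Defensive.

Import Order.TTheory GRing.Theory Num.Theory.
Import numFieldNormedType.Exports.

Local Open Scope classical_set_scope.
Local Open Scope ring_scope.

Section processes.
Context d (T : measurableType d) (R : realType) (P : probability T R).

(* The product rule for subfamilies is the case where B i = setT for the
   omitted indices. *)
Definition mutually_independent (n : nat) (Y : 'I_n -> T -> R) : Prop :=
  forall B : 'I_n -> set R, (forall i, measurable (B i)) ->
    P (\bigcap_i (Y i @^-1` B i)) = (\prod_(i < n) P (Y i @^-1` B i))%E.

(* E[exp(i eta Y)], where cos (eta * Y) and sin (eta * Y) are bounded, so that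
   both expectations are finite. *)
Definition charfun (Y : {RV P >-> R}) (eta : R) : R[i] :=
  Complex (fine 'E_P[fun w => cos (eta * Y w)])
          (fine 'E_P[fun w => sin (eta * Y w)]).

Definition cadlag (f : R -> R) : Prop :=
  (forall t, 0 <= t -> f s @[s --> t^'+] --> f t) /\
  (forall t, 0 < t -> cvg (f s @[s --> t^'-])).

(* A process on [0, +oo[ is a family indexed by R of which only the times
   t >= 0 are constrained. *)
Record levy_process (X : R -> {RV P >-> R}) : Prop := LevyProcess {
  levy_start0 : {ae P, forall w, X 0 w = 0} ;
  levy_indep_increments : forall (n : nat) (t : nat -> R),
    0 <= t 0%N -> {homo t : i j / (i <= j)%N >-> i <= j} ->
    mutually_independent
      (fun i : 'I_n => X (t i.+1) \- X (t i)) ;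
  levy_stationary_increments : forall s h : R, 0 <= s -> 0 <= h ->
    forall B : set R, measurable B ->
    P ((X (s + h) \- X s) @^-1` B) = P (X h @^-1` B) ;
  levy_cadlag : {ae P, forall w, cadlag (fun t => X t w)} }.

Definition symmetric_stable_levy_process
    (rho c : R) (X : R -> {RV P >-> R}) : Prop :=
  levy_process X /\
  forall t eta : R, 0 <= t ->
    charfun (X t) eta = real_complex R (expR (- (c * t * `|eta| `^ rho))).

Definition heat_kernel (eps x : R) : R :=
  (Num.sqrt (2 * pi * eps))^-1 * expR (- (x ^+ 2 / (2 * eps))).

(* On the diagonal r = s (a null set) the weight is 0 `^ (2 * H - 2), which
   is 0 for H < 1 and 1 for H = 1. *)
Definition regularized_silt (X : R -> {RV P >-> R}) (H eps : R) (w : T) :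
    \bar R :=
  (\int[@lebesgue_measure R]_(r in `[0%R, 1%R])
     \int[@lebesgue_measure R]_(s in `[0%R, 1%R])
       (`|r - s| `^ (2 * H - 2) * heat_kernel eps (X r w - X s w))%:E)%E.

Definition weighted_silt (X : R -> {RV P >-> R}) (H : R) (L : T -> R) : Prop :=
  L \in Lfun P 2%:E /\
  ('N[P]_2%:E[regularized_silt X H eps \- (EFin \o L)]
     @[eps --> (0 : R)^'+] --> 0)%E.

End processes.

(* Main.v *)
Require Import Defs.
From HB Require Import structures.
From mathcomp Require Import all_boot all_order all_algebra.
From mathcomp Require Import all_classical all_reals all_analysis.
From mathcomp Require Import measurable_realfun.
From mathcomp.real_closed Require Import complex.
From mathcomp Require Import ring lra.

Set Implicit Arguments.
Unset Strict Implicit.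
Unset Printing Implicit Defensive.

Import Order.TTheory GRing.Theory Num.Theory.
Import numFieldNormedType.Exports.

Local Open Scope classical_set_scope.
Local Open Scope ring_scope.

(** Put [a = 2 * H - 2]; then [-1 < a <= 0], and the hypothesis on [theta] says
    that [a - rho^-1 + 1 > 0].

    Exponential moments.  By Fourier inversion the increment of [X] over a time
    [u] has a density of size at most a constant times [u `^ (- rho^-1)], whatever
    happened before.  For a fixed starting time [r], the functional
    int_r^1 (s - r)^a delta(X_s - X_r) ds therefore has, given the past at a time
    [l], a remaining expectation over a short period that is at most a constant
    times the integral of [v `^ (a - rho^-1)] near the origin; the weight only
    helps, as it decreases in [s].  That integral is finite and small, so
    Khasminskii's iteration ([khasminskii]) bounds every exponential moment.  Jensen's inequality
    over [r] ([expR_average_le]) carries the bound to the double integral.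

    The argument is run on Riemann sums over uniform grids, where the past is
    generated by finitely many independent increments; on grids that are fine
    enough for the width of the heat kernel, the bounds depend neither on the mesh
    nor on this width ([expectation_exp_silt_sum_le]).  Along a cadlag path the sums converge to the
    regularized functional ([riemann_silt_cvg]), which inherits the bounds by
    dominated convergence.

    Existence of the limit.  The heat kernel is a superposition of cosines with
    positive weights that decrease with its width ([heat_kernel_cos]), and the
    expectation of a product of cosines of two increments of [X] is nonnegative
    ([expectation_cos_cos_ge0]).  So the mixed second moment of the regularized
    functionals I_e and I_e' does not increase with either width
    ([expectation_silt_sum2_nincr]).  For e <= e' this gives
    E (I_e - I_e')^2 <= E I_e^2 - E I_e'^2; second moments are bounded, being
    dominated by exponential ones, and the family is Cauchy in quadratic mean
    ([monotone_l2_limit]).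

    Any limit in quadratic mean inherits the exponential bound, by convexity of the
    exponential on the sets where the limit is bounded and Fatou's lemma
    ([expectation_exp_l2_limit]). *)

(** * Integrals and expectations of bounded variables *)

Lemma eq_ler (R : realType) (x y : R) : x = y -> x <= y.
Proof. by move=> ->. Qed.

Section dominated.
Context d (T : measurableType d) (R : realType).
Variable mu : {measure set T -> \bar R}.

Lemma dominated_cvg_ae (D : set T) (f_ : nat -> T -> R) (f g : T -> R) :
  measurable D -> (forall n, measurable_fun D (f_ n)) -> measurable_fun D f ->
  {ae mu, forall x, D x -> f_ n x @[n --> \oo] --> f x} ->
  mu.-integrable D (EFin \o g) ->
  {ae mu, forall x n, D x -> `|f_ n x| <= g x} ->
  mu.-integrable D (EFin \o f) /\
  (\int[mu]_(x in D) f_ n x @[n --> \oo] --> \int[mu]_(x in D) f x).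
Proof.
move=> mD mf_ mf ff ig fg.
have H1 n : measurable_fun D ((fun n => EFin \o f_ n) n) by exact/measurable_EFinP.
have H2 : measurable_fun D (EFin \o f) by exact/measurable_EFinP.
have H3 : {ae mu, forall x, D x ->
    (fun n => EFin \o f_ n) ^~ x @ \oo --> (EFin \o f) x}.
  by apply: filterS ff => x h Dx; apply/cvg_EFin; [near=> n|exact: h].
have H4 : {ae mu, forall x n, D x ->
    (`|((fun n => EFin \o f_ n) n) x| <= (EFin \o g) x)%E}.
  by apply: filterS fg => x h n Dx; rewrite /= lee_fin h.
have [i1 _ c1] := dominated_convergence mD H1 H2 H3 ig H4.
split=> //.
apply: fine_cvg; rewrite fineK//.
exact: integrable_fin_num.
Unshelve. all: end_near. Qed.

Lemma dominated_cvg_EFin (D : set T) (f_ : nat -> T -> R) (f g : T -> R) :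
  measurable D -> (forall n, measurable_fun D (f_ n)) ->
  (forall x, D x -> f_ n x @[n --> \oo] --> f x) ->
  mu.-integrable D (EFin \o g) ->
  (forall x n, D x -> `|f_ n x| <= g x) ->
  (\int[mu]_(x in D) f_ n x @[n --> \oo] --> \int[mu]_(x in D) f x).
Proof.
move=> mD mf_ ff ig fg.
have mf : measurable_fun D f.
  apply/measurable_EFinP.
  apply: (emeasurable_fun_cvg (fun n => EFin \o f_ n)) => [n|x Dx].
    exact/measurable_EFinP.
  by apply/cvg_EFin; [near=> n|exact: ff].
have aeff : {ae mu, forall x, D x -> f_ n x @[n --> \oo] --> f x} by exact: aeW.
have aefg : {ae mu, forall x n, D x -> `|f_ n x| <= g x} by exact: aeW.
by have [] := dominated_cvg_ae mD mf_ mf aeff ig aefg.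
Unshelve. all: end_near. Qed.

End dominated.

Section bounded_random_variables.
Context d (T : measurableType d) (R : realType) (P : probability T R).
Implicit Types (Y Z : T -> R) (g : R -> R).

(** Every variable met before the width of the kernel tends to zero is bounded, so
    that its expectation is a real number and is linear without further condition. *)
Definition bounded_mfun d' (U : measurableType d') (Z : U -> R) :=
  measurable_fun setT Z /\ exists K : R, forall w, `|Z w| <= K.

Lemma bounded_mfun_cst (k : R) : bounded_mfun (fun _ : T => k).
Proof. by split=> //; exists `|k|. Qed.

Lemma bounded_mfunD Y Z : bounded_mfun Y -> bounded_mfun Z ->
  bounded_mfun (fun w => Y w + Z w).
Proof.
move=> [mY [K YK]] [mZ [L ZL]]; split; first exact: measurable_funD.
by exists (K + L) => w; rewrite (le_trans (ler_normD _ _))// lerD.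
Qed.

Lemma bounded_mfunM Y Z : bounded_mfun Y -> bounded_mfun Z ->
  bounded_mfun (fun w => Y w * Z w).
Proof.
move=> [mY [K YK]] [mZ [L ZL]]; split; first exact: measurable_funM.
by exists (K * L) => w; rewrite normrM ler_pM.
Qed.

Lemma bounded_mfunZ (k : R) Y : bounded_mfun Y -> bounded_mfun (fun w => k * Y w).
Proof. by apply: bounded_mfunM; exact: bounded_mfun_cst. Qed.

Lemma bounded_mfunB Y Z : bounded_mfun Y -> bounded_mfun Z ->
  bounded_mfun (fun w => Y w - Z w).
Proof.
move=> bY bZ; rewrite (_ : (fun _ => _) = (fun w => Y w + (-1) * Z w)); last first.
  by apply/funext => w; rewrite mulN1r.
by apply: bounded_mfunD => //; exact: bounded_mfunZ.
Qed.

Lemma bounded_mfun_sum I (s : seq I) (p : pred I) (Y : I -> T -> R) :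
  (forall i, bounded_mfun (Y i)) -> bounded_mfun (fun w => \sum_(i <- s | p i) Y i w).
Proof.
move=> bY; elim: s => [|i s IH].
  by under eq_fun do rewrite big_nil; exact: bounded_mfun_cst.
under eq_fun do rewrite big_cons; case: (p i) => //.
exact: bounded_mfunD.
Qed.

Lemma bounded_mfun_comp g Y : bounded_mfun g -> measurable_fun setT Y ->
  bounded_mfun (fun w => g (Y w)).
Proof. by move=> [mg [K gK]] mY; split; [exact: measurableT_comp|exists K]. Qed.

Lemma bounded_mfun_cos Y : measurable_fun setT Y -> bounded_mfun (fun w => cos (Y w)).
Proof.
apply: bounded_mfun_comp; split; last by exists 1 => w; exact: cos_max.
by apply: continuous_measurable_fun; exact: continuous_cos.
Qed.

Lemma bounded_mfun_sin Y : measurable_fun setT Y -> bounded_mfun (fun w => sin (Y w)).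
Proof.
apply: bounded_mfun_comp; split; last by exists 1 => w; exact: sin_max.
by apply: continuous_measurable_fun; exact: continuous_sin.
Qed.

Lemma bounded_mfun_expR Y : bounded_mfun Y -> bounded_mfun (fun w => expR (Y w)).
Proof.
move=> [mY [K YK]]; split; first exact: measurableT_comp.
exists (expR K) => w; rewrite ger0_norm ?expR_ge0// ler_expR.
by rewrite (le_trans (ler_norm _)).
Qed.

Lemma bounded_mfun_integrable Z : bounded_mfun Z -> P.-integrable setT (EFin \o Z).
Proof.
move=> [mZ [K ZK]].
apply: (@le_integrable _ _ _ P _ measurableT _ (EFin \o cst K)).
- exact/measurable_EFinP.
- by move=> w _ /=; rewrite lee_fin (le_trans (ZK w))// ler_norm.
- exact: finite_measure_integrable_cst.
Qed.

Lemma EFin_Rintegral Z : bounded_mfun Z ->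
  (\int[P]_w (Z w)%:E = (\int[P]_w Z w)%:E)%E.
Proof.
move=> bZ; rewrite /Rintegral fineK//.
by apply: integrable_fin_num => //; exact: bounded_mfun_integrable.
Qed.

Lemma le_expectation Y Z : bounded_mfun Y -> bounded_mfun Z ->
  (forall w, Y w <= Z w) -> \int[P]_w Y w <= \int[P]_w Z w.
Proof. by move=> bY bZ YZ; apply: le_Rintegral => //; exact: bounded_mfun_integrable. Qed.

Lemma expectation_addr Y Z : bounded_mfun Y -> bounded_mfun Z ->
  \int[P]_w (Y w + Z w) = \int[P]_w Y w + \int[P]_w Z w.
Proof. by move=> bY bZ; rewrite RintegralD//; exact: bounded_mfun_integrable. Qed.

Lemma expectation_subr Y Z : bounded_mfun Y -> bounded_mfun Z ->
  \int[P]_w (Y w - Z w) = \int[P]_w Y w - \int[P]_w Z w.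
Proof. by move=> bY bZ; rewrite RintegralB//; exact: bounded_mfun_integrable. Qed.

Lemma expectation_mulr (k : R) Z : bounded_mfun Z ->
  \int[P]_w (k * Z w) = k * \int[P]_w Z w.
Proof. by move=> bZ; rewrite RintegralZl//; exact: bounded_mfun_integrable. Qed.

Lemma expectation_const (k : R) : \int[P]_w k = k.
Proof.
rewrite /Rintegral (integral_cst P measurableT k%:E) -[RHS]/(fine k%:E) -[in RHS](mule1 k%:E).
by congr (fine (_ * _)%E); exact: probability_setT.
Qed.

Lemma expectation_sumr I (s : seq I) (p : pred I) (Y : I -> T -> R) :
  (forall i, bounded_mfun (Y i)) ->
  \int[P]_w (\sum_(i <- s | p i) Y i w) = \sum_(i <- s | p i) \int[P]_w Y i w.
Proof.
move=> bY; elim: s => [|i s IH].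
  by under eq_Rintegral do rewrite big_nil; rewrite big_nil expectation_const.
under eq_Rintegral do rewrite big_cons; rewrite big_cons; case: (p i) => //.
by rewrite expectation_addr ?IH//; exact: bounded_mfun_sum.
Qed.

Lemma norm_expectation_le Z (K : R) : bounded_mfun Z -> (forall w, `|Z w| <= K) ->
  `|\int[P]_w Z w| <= K.
Proof.
move=> bZ ZK; rewrite ler_norml; apply/andP; split.
  rewrite -[- K]expectation_const le_expectation//; first exact: bounded_mfun_cst.
  by move=> w; have := ZK w; rewrite ler_norml => /andP[].
rewrite -[leRHS]expectation_const le_expectation//; first exact: bounded_mfun_cst.
by move=> w; rewrite (le_trans (ler_norm _)).
Qed.

End bounded_random_variables.

(** * The heat kernel as a superposition of cosines *)

Section gauss.
Context {R : realType}.
Notation mu := (@lebesgue_measure R).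
Implicit Types a x y : R.

Definition gauss a y : R := expR (- (a * y ^+ 2)).

Lemma gauss_normal_pdf a y : 0 < a ->
  gauss a y = Num.sqrt (pi / a) * normal_pdf 0 (Num.sqrt (2 * a)^-1) y.
Proof.
move=> a0; have s0 : Num.sqrt (2 * a)^-1 != 0 :> R.
  by rewrite gt_eqF// sqrtr_gt0 invr_gt0 mulr_gt0.
have s2 : Num.sqrt (2 * a)^-1 ^+ 2 = (2 * a)^-1 :> R.
  by rewrite sqr_sqrtr// invr_ge0 mulr_ge0// ltW.
rewrite normal_pdfE// /normal_peak /normal_fun subr0 s2 mulrA.
have -> : (2 * a)^-1 * pi *+ 2 = pi / a :> R.
  by rewrite invfM -mulr_natl; field; rewrite gt_eqF.
rewrite mulfV ?mul1r; last by rewrite gt_eqF// sqrtr_gt0 divr_gt0// pi_gt0.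
by congr expR; rewrite -mulr_natl; field; rewrite gt_eqF.
Qed.

Lemma measurable_gauss a : measurable_fun [set: R] (gauss a).
Proof.
apply: measurableT_comp => //; apply: measurableT_comp => //.
by apply: measurable_funM => //; exact: measurable_funX.
Qed.

Lemma integral_gauss a : 0 < a ->
  (\int[mu]_y (gauss a y)%:E = (Num.sqrt (pi / a))%:E)%E.
Proof.
move=> a0; under eq_integral do rewrite gauss_normal_pdf// EFinM.
rewrite integralZl//; last exact: integrable_normal_pdf.
by rewrite integral_normal_pdf mule1.
Qed.

Lemma integrable_gauss a : 0 < a -> mu.-integrable setT (EFin \o gauss a).
Proof.
move=> a0; apply/integrableP; split.
  by apply/measurable_EFinP; exact: measurable_gauss.
under eq_integral do rewrite /= ger0_norm ?expR_ge0//.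
by rewrite integral_gauss// ltry.
Qed.

Lemma le_norm_gauss a y : 0 < a ->
  `|y| * gauss a y <= (1 + 2 / a) * gauss (a / 2) y.
Proof.
move=> a0.
have -> : gauss a y = gauss (a / 2) y * gauss (a / 2) y.
  by rewrite /gauss -expRD; congr expR; field.
rewrite mulrA ler_wpM2r ?expR_ge0// /gauss expRN ler_pdivrMr ?expR_gt0//.
have h : 1 + a / 2 * y ^+ 2 <= expR (a / 2 * y ^+ 2) by exact: expR_ge1Dx.
apply: (@le_trans _ _ (1 + y ^+ 2)).
  by rewrite -(real_normK (num_real y)); have := normr_ge0 y; nra.
apply: (@le_trans _ _ ((1 + 2 / a) * (1 + a / 2 * y ^+ 2))).
  have -> : (1 + 2 / a) * (1 + a / 2 * y ^+ 2) =
    1 + y ^+ 2 + 2 / a + a / 2 * y ^+ 2 by field; rewrite gt_eqF.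
  rewrite -addrA lerDl addr_ge0//; first by rewrite divr_ge0// ltW.
  by rewrite mulr_ge0 ?sqr_ge0// divr_ge0// ltW.
by rewrite ler_wpM2l// addr_ge0// divr_ge0// ltW.
Qed.

Lemma integrable_norm_gauss a : 0 < a ->
  mu.-integrable setT (EFin \o (fun y => `|y| * gauss a y)).
Proof.
move=> a0; have a20 : 0 < a / 2 by rewrite divr_gt0.
apply: (@le_integrable _ _ _ mu _ measurableT _
  (EFin \o (fun y => (1 + 2 / a) * gauss (a / 2) y))).
- apply/measurable_EFinP; apply: measurable_funM => //.
  exact: measurable_gauss.
- move=> y _ /=; rewrite lee_fin ger0_norm ?mulr_ge0 ?expR_ge0//.
  by rewrite (le_trans (le_norm_gauss y a0))// ler_norm.
- rewrite /comp; under eq_fun do rewrite EFinM.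
  by apply: integrableZl => //; exact: integrable_gauss.
Qed.

Lemma is_derive_gauss a y : is_derive y 1 (gauss a) (- (2 * a * y) * gauss a y).
Proof.
rewrite /gauss; apply: is_derive_eq.
by rewrite /GRing.scale /= !mulr1; ring.
Qed.

Lemma gauss_cvg0 a : 0 < a -> gauss a n%:R @[n --> \oo] --> (0 : R).
Proof.
move=> a0; apply/cvgrPdist_le => e e0; near=> n.
rewrite sub0r normrN ger0_norm ?expR_ge0// /gauss expRN.
have h : a * n%:R ^+ 2 <= expR (a * n%:R ^+ 2) :> R.
  by apply: le_trans (expR_ge1Dx _); rewrite lerDr.
have n1 : (1 <= n%:R :> R) by rewrite ler1n; near: n; exists 1%N.
have nn : (a * e)^-1 <= n%:R.
  by near: n; exact: nbhs_infty_ger.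
have ae0 : 0 < a * e by rewrite mulr_gt0.
rewrite -[leRHS]invrK lef_pV2 ?posrE ?invr_gt0 ?expR_gt0//.
apply: le_trans h.
rewrite (_ : e^-1 = a * (a * e)^-1); last by field; rewrite (gt_eqF e0) (gt_eqF a0).
rewrite ler_wpM2l ?(ltW a0)// (le_trans nn)// expr2 ler_peMr//.
Unshelve. all: end_near. Qed.

(** Integration by parts over the line against the derivative of a Gaussian. *)
Lemma integral_sin_gauss a x : 0 < a ->
  (\int[mu]_y (x * cos (x * y) * gauss a y -
     sin (x * y) * (2 * a * y * gauss a y)) = 0)%R.
Proof.
move=> a0; set f := fun y => _ - _.
pose F y := sin (x * y) * gauss a y.
have dF y : is_derive y 1 F (f y).
  have dg := is_derive_gauss a y.
  apply: is_derive_eq.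
  by rewrite /f /GRing.scale /=; ring.
have cf : continuous f.
  move=> y; rewrite /f; apply: cvgB; (apply: cvgM; last first).
  - by apply/differentiable_continuous/derivable1_diffP; case: (is_derive_gauss a y).
  - apply: cvgM; first exact: cvg_cst.
    apply: continuous_comp; last exact: continuous_cos.
    by apply: cvgM; [exact: cvg_cst|exact: cvg_id].
  - apply: cvgM.
      by apply: cvgM; [exact: cvg_cst|exact: cvg_id].
    by apply/differentiable_continuous/derivable1_diffP; case: (is_derive_gauss a y).
  - apply: continuous_comp; last exact: continuous_sin.
    by apply: cvgM; [exact: cvg_cst|exact: cvg_id].
have mf : measurable_fun setT f by exact: continuous_measurable_fun.
pose G y := `|x| * gauss a y + 2 * a * (`|y| * gauss a y).
have fG y : `|f y| <= G y.
  rewrite /f (le_trans (ler_normB _ _))// /G lerD//.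
    rewrite !normrM (ger0_norm (expR_ge0 _)) ler_wpM2r ?expR_ge0//.
    by rewrite ler_piMr// cos_max.
  have -> : 2 * a * (`|y| * gauss a y) = `|2 * a * y * gauss a y|.
    by rewrite !normrM (ger0_norm (expR_ge0 _)) (gtr0_norm a0) ger0_norm// -!mulrA.
  by rewrite normrM ler_piMl// sin_max.
have iG : mu.-integrable setT (EFin \o G).
  rewrite /comp; under eq_fun do rewrite EFinD 2!EFinM.
  apply: integrableD => //.
    by apply: integrableZl => //; exact: integrable_gauss.
  rewrite (_ : (fun _ => _) = (fun y => (2 * a)%:E * (`|y| * gauss a y)%:E)%E); last first.
    by apply/funext => y; rewrite -!EFinM.
  by apply: integrableZl => //; exact: integrable_norm_gauss.
pose fn n : R -> R := f \_ (`[- n%:R, n%:R]).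
have fnE n : (0 < n)%N -> (\int[mu]_y (fn n y)%:E = (F n%:R - F (- n%:R))%:E)%E.
  move=> n0.
  have -> : (fun y => (fn n y)%:E) = (EFin \o f) \_ `[- n%:R, n%:R].
    by rewrite restrict_EFin.
  rewrite -integral_mkcond.
  rewrite (@continuous_FTC2 _ f F)//.
  - by rewrite gtrN ?ltr0n.
  - exact: continuous_subspaceT.
  - by split; [move=> y _; exact: ex_derive|
      apply: cvg_at_right_filter; apply/differentiable_continuous/derivable1_diffP; exact: ex_derive|
      apply: cvg_at_left_filter; apply/differentiable_continuous/derivable1_diffP; exact: ex_derive].
  - by move=> y _; rewrite derive1E; exact: derive_val.
have lim0 : (\int[mu]_y (fn n y)%:E @[n --> \oo] --> 0)%E.
  apply: (@cvg_trans _ ((F n%:R - F (- n%:R))%:E @[n --> \oo])%E).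
    apply: near_eq_cvg; near=> n; rewrite fnE//; near: n; exact: nbhs_infty_gt.
  apply/cvg_EFin; first by near=> n.
  rewrite /comp /=.
  have gn := gauss_cvg0 a0.
  have gn2 : (2 : R) * gauss a n%:R @[n --> \oo] --> (0 : R).
    by rewrite -(mulr0 2); apply: cvgM; [exact: cvg_cst|exact: gn].
  apply/norm_cvg0P; apply: (squeeze_cvgr _ (cvg_cst 0) gn2).
  near=> n => /=; rewrite normr_ge0 /= /F.
  have -> : gauss a (- n%:R) = gauss a n%:R by rewrite /gauss sqrrN.
  rewrite -mulrBl normrM (ger0_norm (expR_ge0 _)) ler_wpM2r ?expR_ge0//.
  by rewrite (le_trans (ler_normB _ _))// -(_ : 1 + 1 = 2 :> R)// lerD ?sin_max.
have mfn n : measurable_fun setT (fn n).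
  by apply/(measurable_restrict _ _ _).1 => //; exact: measurable_funTS.
have fnf y : fn n y @[n --> \oo] --> f y.
  apply: (@cvg_trans _ ((f y) @[n --> \oo])); last exact: cvg_cst.
  apply: near_eq_cvg; near=> n; rewrite /fn patchE mem_set//= in_itv/= -ler_norml.
  near: n; exact: nbhs_infty_ger.
have fnG n y : `|fn n y| <= G y.
  rewrite /fn patchE; case: ifP => _ //.
  by rewrite normr0 addr_ge0 ?mulr_ge0 ?expR_ge0// ltW.
have iGf := @dominated_cvg_EFin _ _ _ mu setT fn f G measurableT mfn
  (fun y _ => fnf y) iG (fun y n _ => fnG n y).
by apply: (cvg_unique _ iGf) => //; exact: (fine_cvg lim0).
Unshelve. all: end_near. Qed.

Definition gauss_cos a x : R := \int[mu]_y (cos (x * y) * gauss a y).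

Lemma integrable_bounded_gauss a (f : R -> R) : 0 < a ->
  measurable_fun setT f -> (forall y, `|f y| <= 1) ->
  mu.-integrable setT (EFin \o (fun y => f y * gauss a y)).
Proof.
move=> a0 mf f1.
apply: (@le_integrable _ _ _ mu _ measurableT _ (EFin \o gauss a)) => //.
- apply/measurable_EFinP; apply: measurable_funM => //; exact: measurable_gauss.
- by move=> y _ /=; rewrite lee_fin normrM ler_piMl.
- exact: integrable_gauss.
Qed.

Lemma measurable_cosM x : measurable_fun setT (fun y : R => cos (x * y)).
Proof.
apply: continuous_measurable_fun => y.
apply: continuous_comp; last exact: continuous_cos.
by apply: cvgM; [exact: cvg_cst|exact: cvg_id].
Qed.

Lemma measurable_sinM x : measurable_fun setT (fun y : R => sin (x * y)).
Proof.
apply: continuous_measurable_fun => y.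
apply: continuous_comp; last exact: continuous_sin.
by apply: cvgM; [exact: cvg_cst|exact: cvg_id].
Qed.

Lemma is_derive_gauss_cos a x : 0 < a ->
  is_derive x 1 (gauss_cos a) (- (x / (2 * a)) * gauss_cos a x).
Proof.
move=> a0.
pose f (x y : R) : R := cos (x * y) * gauss a y.
have df (z y : R) : is_derive z 1 (f ^~ y) (- (y * sin (z * y)) * gauss a y).
  rewrite /f; apply: is_derive_eq.
  by rewrite /GRing.scale /=; ring.
have pf z y : partial1of2 f z y = - (y * sin (z * y)) * gauss a y.
  by rewrite partial1of2E; exact: derive_val.
have I x0 : mu.-integrable setT (EFin \o f x0).
  by apply: integrable_bounded_gauss => // [|y]; [exact: measurable_cosM|exact: cos_max].
have xI : `]x - 1, x + 1[%classic x by rewrite /= in_itv/=; apply/andP; split; lra.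
have G0 y : 0 <= `|y| * gauss a y by rewrite mulr_ge0 ?expR_ge0.
have Gub z y : `]x - 1, x + 1[%classic z -> setT y -> `|partial1of2 f z y| <= `|y| * gauss a y.
  move=> _ _; rewrite pf normrM normrN normrM (ger0_norm (expR_ge0 _)).
  by rewrite ler_wpM2r ?expR_ge0// ler_piMr// sin_max.
have der z y : `]x - 1, x + 1[%classic z -> setT y -> derivable (f ^~ y) z 1.
  by move=> _ _; case: (df z y).
have dF := @derivable_under_integral R _ _ mu f setT measurableT x _ _ xI
  (fun z _ => I z) der _ G0 (integrable_norm_gauss a0) Gub.
have dFE := @differentiation_under_integral R _ _ mu f setT measurableT x _ _ xI
  (fun z _ => I z) der _ G0 (integrable_norm_gauss a0) Gub.
apply: DeriveDef => //; rewrite -derive1E dFE.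
have i1 : mu.-integrable setT (EFin \o (fun y => x * cos (x * y) * gauss a y)).
  rewrite (_ : _ \o _ = (fun y => x%:E * (f x y)%:E)%E); last first.
    by apply/funext => y; rewrite /f /= -EFinM mulrA.
  by apply: integrableZl => //; exact: I.
have i2 : mu.-integrable setT
    (EFin \o (fun y => sin (x * y) * (2 * a * y * gauss a y))).
  apply: (@le_integrable _ _ _ mu _ measurableT _
    (EFin \o (fun y => 2 * a * (`|y| * gauss a y)))).
  - apply/measurable_EFinP; apply: measurable_funM; first exact: measurable_sinM.
    by apply: measurable_funM; [apply: measurable_funM|exact: measurable_gauss].
  - move=> y _ /=; rewrite lee_fin.
    have -> : 2 * a * (`|y| * gauss a y) = `|2 * a * y * gauss a y|.
      by rewrite !normrM (ger0_norm (expR_ge0 _)) (gtr0_norm a0) ger0_norm// -!mulrA.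
    by rewrite normrM normr_id ler_piMl// sin_max.
  - rewrite (_ : _ \o _ = (fun y => (2 * a)%:E * (`|y| * gauss a y)%:E)%E); last first.
      by apply/funext => y; rewrite /= -EFinM.
    by apply: integrableZl => //; exact: integrable_norm_gauss.
have := integral_sin_gauss x a0.
rewrite RintegralB// => /eqP; rewrite subr_eq0 => /eqP e.
have e1 : (\int[mu]_y (x * cos (x * y) * gauss a y) = x * gauss_cos a x)%R.
  rewrite -RintegralZl//; last exact: I.
  by apply: eq_Rintegral => y _; rewrite /f mulrA.
rewrite (_ : (fun y => _) = (fun y => - (2 * a)^-1 * (sin (x * y) * (2 * a * y * gauss a y)))); last first.
  by apply/funext => y; rewrite pf; field; rewrite gt_eqF.
rewrite RintegralZl// -e e1; field; rewrite gt_eqF//.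
Qed.

(** The Fourier transform of a Gaussian, from the differential equation
    [phi' x = - (x / 2 a) phi x] that integration by parts provides. *)
Lemma gauss_cosE a x : 0 < a ->
  gauss_cos a x = Num.sqrt (pi / a) * expR (- (x ^+ 2 / (4 * a))).
Proof.
move=> a0.
pose h z := gauss_cos a z * expR (z ^+ 2 / (4 * a)).
have dh (z : R) : is_derive z 1 h 0.
  have := is_derive_gauss_cos z a0 => d1.
  rewrite /h; apply: is_derive_eq.
  rewrite /GRing.scale /=; field; rewrite gt_eqF//.
have h0 : h x = h 0 by apply: is_derive_0_is_cst.
have : h 0 = Num.sqrt (pi / a).
  rewrite /h /gauss_cos expr0n/= mul0r expR0 mulr1.
  under eq_Rintegral do rewrite mul0r cos0 mul1r.
  by rewrite /Rintegral integral_gauss.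
rewrite -h0 => <-; rewrite /h -mulrA -expRD subrr expR0 mulr1//.
Qed.

(** The heat kernel as a superposition of cosines with positive weights. *)
Lemma heat_kernel_cos (eps x : R) : 0 < eps ->
  heat_kernel eps x = (2 * pi)^-1 * gauss_cos (eps / 2) x.
Proof.
move=> e0; rewrite gauss_cosE ?divr_gt0// /heat_kernel.
have p0 := pi_gt0 R.
rewrite (_ : x ^+ 2 / (4 * (eps / 2)) = x ^+ 2 / (2 * eps)); last first.
  by field; rewrite gt_eqF.
rewrite mulrA; congr (_ * _).
have -> : pi / (eps / 2) = (2 * pi) ^+ 2 / (2 * pi * eps) :> R.
  by move: (pi : R) p0 => q q0; field; rewrite (gt_eqF e0) (gt_eqF q0).
rewrite [in RHS]sqrtrM ?sqr_ge0// sqrtr_sqr ger0_norm ?mulr_ge0 ?(ltW p0)//.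
by rewrite sqrtrV ?mulr_ge0 ?(ltW p0) ?(ltW e0)// mulrA mulVf ?mul1r// gt_eqF// mulr_gt0.
Qed.

Definition heat_peak (eps : R) : R := (Num.sqrt (2 * pi * eps))^-1.

Lemma heat_kernel_ge0 (eps x : R) : 0 <= heat_kernel eps x.
Proof. by rewrite mulr_ge0 ?expR_ge0// invr_ge0 sqrtr_ge0. Qed.

Lemma heat_kernel_le (eps x : R) : 0 < eps -> heat_kernel eps x <= heat_peak eps.
Proof.
move=> e0; rewrite ler_piMr ?invr_ge0 ?sqrtr_ge0// -[leRHS]expR0 ler_expR oppr_le0.
by rewrite divr_ge0 ?sqr_ge0// mulr_ge0// ltW.
Qed.

Lemma continuous_heat_kernel (eps : R) : continuous (heat_kernel eps).
Proof.
move=> x; apply: cvgM; first exact: cvg_cst.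
apply: continuous_comp; last exact: continuous_expR.
by apply: cvgN; apply: cvgM; [exact: exprn_continuous|exact: cvg_cst].
Qed.

Lemma bounded_mfun_heat_kernel d (T : measurableType d) (eps : R) (V : T -> R) :
  0 < eps -> measurable_fun setT V -> bounded_mfun (fun w => heat_kernel eps (V w)).
Proof.
move=> e0; apply: bounded_mfun_comp; split.
  by apply: continuous_measurable_fun; exact: continuous_heat_kernel.
exists (heat_peak eps) => x; rewrite ger0_norm ?heat_kernel_ge0//.
exact: heat_kernel_le.
Qed.

End gauss.

(** * Expectations of the heat kernel *)

Section laplace.
Context {R : realType}.
Notation mu := (@lebesgue_measure R).

Lemma integral_expR_norm (m : R) : 0 < m ->
  (\int[mu]_y (expR (- (m * `|y|)))%:E = (2 / m)%:E)%E.
Proof.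
move=> m0.
have ce : continuous (fun y : R => expR (- (m * `|y|))).
  move=> y; apply: continuous_comp; last exact: continuous_expR.
  apply: cvgN; apply: cvgM; first exact: cvg_cst.
  by apply: cvg_norm; exact: cvg_id.
have ee : (fun y : R => expR (- (m * `|y|))) =1 (fun y : R => expR (- (m * `|y|))) \o -%R.
  by move=> y /=; rewrite normrN.
rewrite (ge0_symfun_integralT (fun y => expR_ge0 _) ce ee).
rewrite (_ : (2 / m)%:E = 2%:E * ((m^-1)%:E * 1%:E))%E; last first.
  by rewrite -!EFinM mulr1.
congr (_ * _)%E; rewrite -(integral_exponential_pdf m0) -integralZl//; last first.
  apply/integrableP; split.
    by apply/measurable_EFinP; exact: measurable_exponential_pdf.
  under eq_integral => y _ do rewrite /= ger0_norm ?exponential_pdf_ge0 ?(ltW m0)//.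
  by rewrite integral_exponential_pdf// ltry.
rewrite [LHS]integral_mkcond; apply: eq_integral => y _.
rewrite patchE /exponential_pdf patchE set_itvcy.
case: ifPn => yP; last by rewrite mule0.
by move: yP; rewrite inE /= => y0; rewrite -EFinM mulrA mulVf ?gt_eqF// mul1r ger0_norm// mulNr.
Qed.

(** Comparison of a stretched exponential with an ordinary one, which has
    an explicit integral and the right scaling. *)
Lemma expR_powR_le (t rho y : R) : 0 < t -> 1 <= rho ->
  expR (- (t * `|y| `^ rho)) <= expR 1 * expR (- (t `^ rho^-1 * `|y|)).
Proof.
move=> t0 r1; have r0 : 0 < rho by apply: lt_le_trans r1.
rewrite -expRD ler_expR lerNl opprD opprK addrC lerBlDr.
set m := t `^ rho^-1; have m0 : 0 <= m by exact: powR_ge0.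
have -> : t * `|y| `^ rho = (m * `|y|) `^ rho.
  by rewrite powRM// /m -powRrM mulVf ?gt_eqF// powRr1// ltW.
have : 0 <= m * `|y| by rewrite mulr_ge0.
move: (m * `|y|) => u u0.
have [u1|u1] := leP u 1; first by rewrite (le_trans u1)// lerDr powR_ge0.
have : u <= u `^ rho by rewrite -[leLHS]powRr1// ler_powR// ltW.
lra.
Qed.

Context d (T : measurableType d) (P : probability T R).

Lemma integrable_cos_gauss_fubini (eps : R) (Z V : T -> R) : 0 < eps ->
  bounded_mfun Z -> measurable_fun setT V ->
  (P \x mu)%E.-integrable setT
    (fun z : T * R => (Z z.1 * cos (V z.1 * z.2) * gauss eps z.2)%:E).
Proof.
move=> e0 [mZ [K ZK]] mV.
have mf : measurable_fun setT
    (fun z : T * R => (Z z.1 * cos (V z.1 * z.2) * gauss eps z.2)%:E).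
  apply/measurable_EFinP; apply: measurable_funM.
    apply: measurable_funM; first exact: measurableT_comp.
    apply: measurableT_comp.
      by apply: continuous_measurable_fun; exact: continuous_cos.
    by apply: measurable_funM => //; exact: measurableT_comp.
  by apply: measurableT_comp => //; exact: measurable_gauss.
apply/integrable12ltyP => //=.
apply: (@le_lt_trans _ _ (\int[P]_w \int[mu]_y (`|K| * gauss eps y)%:E)%E).
  apply: ge0_le_integral => //.
  - by move=> w _; apply: integral_ge0 => y _; rewrite lee_fin.
  - apply: (@measurable_fun_fubini_tonelli_F _ _ _ _ _ mu
      (fun z : T * R => `|(Z z.1 * cos (V z.1 * z.2) * gauss eps z.2)%:E|)%E) => //.
    exact: measurableT_comp.
  - move=> w _; apply: ge0_le_integral => //.
    + apply/measurable_EFinP; apply: (measurableT_comp (@normr_measurable R setT)).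
      by apply: measurable_funM; [apply: measurable_funM => //; exact: measurable_cosM|
        exact: measurable_gauss].
    + by apply/measurable_EFinP; apply: measurable_funM => //; exact: measurable_gauss.
    + move=> y _; rewrite /= lee_fin normrM (ger0_norm (expR_ge0 _)) ler_wpM2r ?expR_ge0//.
      rewrite normrM (@le_trans _ _ `|Z w|)//; first by rewrite ler_piMr// cos_max.
      by rewrite (le_trans (ZK w))// ler_norm.
under eq_integral => w _.
  under eq_integral do rewrite EFinM.
  rewrite integralZl//; last exact: integrable_gauss.
  rewrite integral_gauss// -EFinM; over.
rewrite EFin_Rintegral ?ltry//; exact: bounded_mfun_cst.
Qed.

Lemma measurable_cosMr (V : T -> R) y : measurable_fun setT V ->
  measurable_fun setT (fun w => V w * y).
Proof. by move=> mV; exact: measurable_funM. Qed.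

(** Fourier inversion under the expectation, by Fubini's theorem.  The factor [Z]
    stands for what is known before the increment [V]. *)
Lemma expectation_heat_kernel (eps : R) (Z V : T -> R) : 0 < eps ->
  bounded_mfun Z -> measurable_fun setT V ->
  mu.-integrable setT
    (EFin \o (fun y => gauss (eps / 2) y * \int[P]_w (Z w * cos (V w * y)))) /\
  \int[P]_w (Z w * heat_kernel eps (V w)) =
  (2 * pi)^-1 * \int[mu]_y (gauss (eps / 2) y * \int[P]_w (Z w * cos (V w * y))).
Proof.
move=> e0 bZ mV; have e20 : 0 < eps / 2 by rewrite divr_gt0.
have IF := integrable_cos_gauss_fubini e20 bZ mV.
have G_E : fubini_G P (fun z : T * R => (Z z.1 * cos (V z.1 * z.2) * gauss (eps / 2) z.2)%:E)
    = EFin \o (fun y => gauss (eps / 2) y * \int[P]_w (Z w * cos (V w * y))).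
  apply/funext => y; rewrite /fubini_G /=.
  have b1 : bounded_mfun (fun w => Z w * cos (V w * y)).
    by apply: bounded_mfunM => //; apply: bounded_mfun_cos; exact: measurable_cosMr.
  rewrite -expectation_mulr// -EFin_Rintegral; last exact: bounded_mfunZ.
  by apply: eq_integral => w _; rewrite mulrC.
split.
  have [mZ [K ZK]] := bZ.
  apply: (@le_integrable _ _ _ mu _ measurableT _ (EFin \o (fun y => K * gauss (eps / 2) y))).
  - by rewrite -G_E; exact: (measurable_fubini_G IF).
  - move=> y _ /=; rewrite lee_fin.
    rewrite normrM (ger0_norm (expR_ge0 _)) mulrC.
    rewrite (le_trans _ (ler_norm _))// ler_wpM2r ?expR_ge0//.
    apply: norm_expectation_le => [|w].
      by apply: bounded_mfunM => //; apply: bounded_mfun_cos; exact: measurable_cosMr.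
    by rewrite normrM (le_trans _ (ZK w))// ler_piMr// cos_max.
  - rewrite /comp; under eq_fun do rewrite EFinM.
    by apply: integrableZl => //; exact: integrable_gauss.
have F_E w : (\int[mu]_y (Z w * cos (V w * y) * gauss (eps / 2) y)%:E =
    (2 * pi * (Z w * heat_kernel eps (V w)))%:E)%E.
  under eq_integral do rewrite -mulrA EFinM.
  have ig : mu.-integrable setT (EFin \o (fun y => cos (V w * y) * gauss (eps / 2) y)).
    by apply: integrable_bounded_gauss => // [|y];
      [exact: measurable_cosM|exact: cos_max].
  rewrite integralZl// heat_kernel_cos//.
  have -> : (\int[mu]_y (cos (V w * y) * gauss (eps / 2) y)%:E = (gauss_cos (eps / 2) (V w))%:E)%E.
    by rewrite /gauss_cos /Rintegral fineK//; exact: integrable_fin_num.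
  rewrite -EFinM; congr EFin; rewrite mulrCA (mulrA (2 * pi)) mulfV ?mul1r//.
  by rewrite gt_eqF// mulr_gt0// pi_gt0.
have := Fubini IF; rewrite /=.
under eq_integral do rewrite F_E.
move=> H.
rewrite [in RHS]/Rintegral.
have <- : (\int[mu]_y \int[P]_w (Z w * cos (V w * y) * gauss (eps / 2) y)%:E =
   \int[mu]_y (gauss (eps / 2) y * \int[P]_w (Z w * cos (V w * y)))%:E)%E.
  apply: eq_integral => y _.
  by have := congr1 (fun f => f y) G_E; rewrite /fubini_G /=.
rewrite -H.
have p0 : 0 < 2 * pi :> R by rewrite mulr_gt0// pi_gt0.
have bh : bounded_mfun (fun w => Z w * heat_kernel eps (V w)).
  by apply: bounded_mfunM => //; exact: bounded_mfun_heat_kernel.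
rewrite EFin_Rintegral; last exact: bounded_mfunZ.
by rewrite /= expectation_mulr// mulrA mulVf ?mul1r// gt_eqF.
Qed.

(** Positive-definiteness makes expectations of the heat kernel decrease in
    its width: only the Gaussian weights depend on it. *)
Lemma expectation_heat_kernel_nincr (eps1 eps2 : R) (Z V : T -> R) :
  0 < eps1 -> eps1 <= eps2 -> bounded_mfun Z -> measurable_fun setT V ->
  (forall y, 0 <= \int[P]_w (Z w * cos (V w * y))) ->
  \int[P]_w (Z w * heat_kernel eps2 (V w)) <=
  \int[P]_w (Z w * heat_kernel eps1 (V w)).
Proof.
move=> e10 e12 bZ mV pos; have e20 : 0 < eps2 by apply: lt_le_trans e12.
have [i1 ->] := expectation_heat_kernel e10 bZ mV.
have [i2 ->] := expectation_heat_kernel e20 bZ mV.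
rewrite ler_wpM2l ?invr_ge0 ?mulr_ge0 ?pi_ge0//.
apply: le_Rintegral => // y _; rewrite ler_wpM2r//.
rewrite ler_expR lerN2 ler_wpM2r ?sqr_ge0//; lra.
Qed.

Lemma expectation_heat_kernel_ge0 (eps : R) (Z V : T -> R) :
  0 < eps -> bounded_mfun Z -> measurable_fun setT V ->
  (forall y, 0 <= \int[P]_w (Z w * cos (V w * y))) ->
  0 <= \int[P]_w (Z w * heat_kernel eps (V w)).
Proof.
move=> e0 bZ mV pos.
have [i1 ->] := expectation_heat_kernel e0 bZ mV.
rewrite mulr_ge0 ?invr_ge0 ?mulr_ge0 ?pi_ge0//.
by apply: Rintegral_ge0 => y _; rewrite mulr_ge0 ?expR_ge0.
Qed.

(** A stable variable at time [t] has a density of size at most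
    [t `^ (- rho^-1)], uniformly in the position. *)
Lemma stable_heat_kernel_le (eps t rho x : R) (Y : T -> R) :
  0 < eps -> 0 < t -> 1 <= rho -> measurable_fun setT Y ->
  (forall b, \int[P]_w cos (b * Y w) = expR (- (t * `|b| `^ rho))) ->
  (forall b, \int[P]_w sin (b * Y w) = 0) ->
  \int[P]_w heat_kernel eps (x + Y w) <= expR 1 / pi * t `^ (- rho^-1).
Proof.
move=> e0 t0 r1 mY Yc Ys.
have mxY : measurable_fun setT (fun w => x + Y w) by exact: measurable_funD.
have [] := expectation_heat_kernel e0 (bounded_mfun_cst T 1) mxY.
under [X in _ -> X = _ -> _]eq_Rintegral do rewrite mul1r.
move=> i1 ->.
have tr0 : 0 < t `^ rho^-1 by exact: powR_gt0.
have -> : expR 1 / pi * t `^ (- rho^-1) = (2 * pi)^-1 * (expR 1 * (2 / t `^ rho^-1)).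
  rewrite powRN; have := pi_gt0 R; move: (pi : R) => q q0.
  by field; rewrite (gt_eqF q0) (gt_eqF tr0).
rewrite ler_wpM2l ?invr_ge0 ?mulr_ge0 ?pi_ge0//.
have iE : mu.-integrable setT (EFin \o (fun y => expR (- (t `^ rho^-1 * `|y|)))).
  apply/integrableP; split.
    apply/measurable_EFinP; apply: measurableT_comp => //.
    by apply: measurableT_comp => //; apply: measurable_funM.
  under eq_integral => y _ do rewrite /= ger0_norm ?expR_ge0//.
  by rewrite integral_expR_norm// ltry.
have <- : \int[mu]_y (expR 1 * expR (- (t `^ rho^-1 * `|y|))) = expR 1 * (2 / t `^ rho^-1).
  by rewrite RintegralZl// {1}/Rintegral integral_expR_norm.
apply: le_Rintegral => //.
  rewrite /comp; under eq_fun do rewrite EFinM.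
  exact: integrableZl.
move=> y _.
have -> : \int[P]_w (1 * cos ((x + Y w) * y)) = cos (x * y) * expR (- (t * `|y| `^ rho)).
  have bc : bounded_mfun (fun w => cos (y * Y w)) by apply: bounded_mfun_cos; exact: measurable_funM.
  have bs : bounded_mfun (fun w => sin (y * Y w)) by apply: bounded_mfun_sin; exact: measurable_funM.
  transitivity (\int[P]_w (cos (x * y) * cos (y * Y w) - sin (x * y) * sin (y * Y w))).
    by apply: eq_Rintegral => w _; rewrite mul1r mulrDl cosD (mulrC (Y w)).
  rewrite expectation_subr; [|exact: bounded_mfunZ..].
  by rewrite !expectation_mulr// Yc Ys mulr0 subr0.
apply: le_trans (expR_powR_le y t0 r1).
rewrite mulrA ler_piMl ?expR_ge0//.
apply: (@le_trans _ _ (1 * 1)); last by rewrite mulr1.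
rewrite (le_trans (ler_norm _))// normrM ler_pM// ?cos_max//.
rewrite ger0_norm ?expR_ge0// -[leRHS]expR0 ler_expR oppr_le0.
by rewrite mulr_ge0 ?sqr_ge0// ltW// divr_gt0.
Qed.

End laplace.

(** * Independence of a variable and a sigma-algebra *)

Section independence.
Context d (T : measurableType d) (R : realType) (P : probability T R).

Lemma eq_law_expectation (Y Y' : T -> R) (g : R -> R) :
  measurable_fun setT Y -> measurable_fun setT Y' ->
  (forall B, measurable B -> P (Y @^-1` B) = P (Y' @^-1` B)) ->
  bounded_mfun g ->
  \int[P]_w g (Y w) = \int[P]_w g (Y' w).
Proof.
move=> mY mY' YY' bg; rewrite /Rintegral.
have mg : measurable_fun setT (EFin \o g) by apply/measurable_EFinP; case: bg.
have ig Z : measurable_fun setT Z ->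
    P.-integrable (Z @^-1` setT) ((EFin \o g) \o Z).
  by move=> mZ; rewrite preimage_setT; exact/bounded_mfun_integrable/bounded_mfun_comp.
have iE Z (mZ : measurable_fun setT Z) : (\int[P]_w (g (Z w))%:E =
    \int[pushforward P Z]_y (g y)%:E)%E.
  by rewrite (integral_pushforward mZ mg (ig _ mZ))// preimage_setT.
rewrite !iE//; congr fine.
apply: (@eq_measure_integral _ _ _ setT (pushforward P Y') (pushforward P Y)).
by move=> A mA _; exact: YY'.
Qed.

Variable G : set (set T).
Hypothesis Gmeas : G `<=` measurable.
Hypothesis GI : setI_closed G.
Hypothesis GT : G setT.

Lemma sub_g_sigma_algebra : <<s G >> `<=` @measurable d T.
Proof. by apply: smallest_sub => //; exact: sigma_algebra_measurable. Qed.

Lemma measurable_fun_sub_sigma d' (U : measurableType d') (Z : T -> U) :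
  measurable_fun setT (Z : g_sigma_algebraType G -> U) -> measurable_fun setT Z.
Proof.
move=> mZ _ B mB; have := mZ measurableT B mB.
by rewrite !setTI; exact: sub_g_sigma_algebra.
Qed.

Variable Y : T -> R.
Hypothesis mY : measurable_fun setT Y.
Hypothesis indep : forall A B, G A -> measurable B ->
  P (A `&` Y @^-1` B) = (P A * P (Y @^-1` B))%E.

Let mYB B : measurable B -> measurable (Y @^-1` B).
Proof. by move=> mB; rewrite -[X in measurable X]setTI; exact: mY. Qed.

(** Independence passes from a pi-system to the sigma-algebra it generates: both
    sides are finite measures in [A] that agree on the pi-system. *)
Lemma indep_g_sigma_algebra A B : <<s G >> A -> measurable B ->
  P (A `&` Y @^-1` B) = (P A * P (Y @^-1` B))%E.
Proof.
move=> GA mB; have mE := mYB mB.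
have p0 : 0 <= fine (P (Y @^-1` B)) by rewrite fine_ge0.
have pE : P (Y @^-1` B) = (fine (P (Y @^-1` B)))%:E.
  by rewrite fineK// fin_num_measure.
have cov : \bigcup_(k : nat) [set: T] = setT by rewrite bigcup_const//; exists 0%N.
have := @g_sigma_algebra_measure_unique _ R T G Gmeas (fun=> setT) (fun=> GT)
  cov (mrestr P mE) (mscale (NngNum p0) P) GI.
move=> H; rewrite [RHS]muleC pE; apply: H => //.
  move=> C GC; apply: (etrans (indep GC mB)).
  by rewrite muleC [X in (X * _)%E]pE.
move=> _; apply: (@le_lt_trans _ _ 1%E); last exact: ltry.
by apply: (@probability_le1 _ _ _ P); exact: measurableI.
Qed.

(** The joint law of the past and of an independent variable is the product
    of their laws, so that Tonelli's theorem integrates the latter out. *)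
Lemma tonelli_indep (f : g_sigma_algebraType G * R -> \bar R) :
  measurable_fun setT f -> (forall z, 0 <= f z)%E ->
  (\int[P]_w f (w, Y w) = \int[P]_w \int[P]_w' f (w, Y w'))%E.
Proof.
move=> mf f0; pose F := g_sigma_algebraType G.
have mid : measurable_fun setT (id : T -> F).
  by move=> _ A mA; rewrite setTI; exact: sub_g_sigma_algebra.
have mJ : measurable_fun setT (fun w => (w, Y w) : F * R).
  by apply: measurable_fun_pair.
pose I' : {mfun T >-> F} := mfun_Sub (mem_set mid).
pose Y' : {mfun T >-> R} := mfun_Sub (mem_set mY).
pose J' : {mfun T >-> (F * R)%type} := mfun_Sub (mem_set mJ).
have prodE A : measurable A ->
    (distribution P I' \x distribution P Y')%E A = distribution P J' A.
  apply: product_measure_unique => B C mB mC.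
  by rewrite /distribution /pushforward /=; exact: indep_g_sigma_algebra.
transitivity (\int[distribution P J']_z f z)%E.
  by rewrite ge0_integral_distribution.
transitivity (\int[(distribution P I' \x distribution P Y')%E]_z f z)%E.
  by apply: eq_measure_integral => A mA _; exact/esym/prodE.
rewrite fubini_tonelli1// ge0_integral_distribution//; last 2 first.
- exact: measurable_fun_fubini_tonelli_F.
- by move=> w; exact: integral_ge0.
apply: eq_integral => w _; rewrite /fubini_F /=.
rewrite ge0_integral_distribution//.
by apply: measurableT_comp => //; exact: measurable_pair1.
Qed.

End independence.

(** * The past of a process along a grid *)

Section levy.
Context d (T : measurableType d) (R : realType) (P : probability T R).
Variable X : R -> {RV P >-> R}.

(** The rectangles that the increments over a grid define, a pi-system. *)
Definition past (t : nat -> R) (l : nat) : set (set T) :=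
  [set A | exists B : nat -> set R, (forall i, measurable (B i)) /\
    A = \bigcap_(i in `I_l) ((X (t i.+1) \- X (t i)) @^-1` B i)].

Lemma measurable_incr s t : measurable_fun setT (X t \- X s).
Proof. exact: measurable_funB. Qed.

Lemma past_measurable t l : past t l `<=` measurable.
Proof.
move=> _ [B [mB ->]]; apply: bigcap_measurableType => i _.
by rewrite -[X in measurable X]setTI; exact: measurable_incr.
Qed.

Lemma past_setI t l : setI_closed (past t l).
Proof.
move=> _ _ [B [mB ->]] [C [mC ->]]; exists (fun i => B i `&` C i).
split; first by move=> i; exact: measurableI.
by rewrite -bigcapI; apply: eq_bigcapr => i _; rewrite preimage_setI.
Qed.

Lemma past_setT t l : past t l setT.
Proof.
exists (fun=> setT); split=> //.
by rewrite bigcapT// => i _; rewrite preimage_setT.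
Qed.

Lemma past_sub t l l' : (l <= l')%N -> past t l `<=` past t l'.
Proof.
move=> ll' _ [B [mB ->]]; exists (fun i => if (i < l)%N then B i else setT).
split; first by move=> i; case: ifP.
apply/seteqP; split=> w H i /= il'.
  by case: ifPn => // il; exact: H.
by have := H i (leq_trans il' ll'); rewrite /= il'.
Qed.

Definition adapted t l (Z : T -> R) :=
  measurable_fun setT (Z : g_sigma_algebraType (past t l) -> R).

Lemma adapted_sub t l l' Z : (l <= l')%N -> adapted t l Z -> adapted t l' Z.
Proof.
move=> ll' aZ _ B mB; have := aZ measurableT B mB.
rewrite /measurable/= !setTI; apply: sub_smallest2r; last exact: past_sub.
exact: smallest_sigma_algebra.
Qed.

Lemma adapted_measurable t l Z : adapted t l Z -> measurable_fun setT Z.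
Proof. by apply: measurable_fun_sub_sigma; exact: past_measurable. Qed.

Lemma adapted_incr t l i : (i < l)%N -> adapted t l (X (t i.+1) \- X (t i)).
Proof.
move=> il _ B mB; rewrite setTI; apply: sub_sigma_algebra.
exists (fun j => if j == i then B else setT).
split; first by move=> j; case: ifP.
apply/seteqP; split=> w H.
  by move=> j _; case: eqP => // ->.
by have := H i il; rewrite eqxx.
Qed.

Lemma adapted_incr0 t l i : (i <= l)%N -> adapted t l (X (t i) \- X (t 0%N)).
Proof.
elim: i => [_|i IH il].
  have -> : X (t 0%N) \- X (t 0%N) = cst 0 by apply/funext => w /=; rewrite subrr.
  exact: measurable_cst.
have -> : X (t i.+1) \- X (t 0%N) =
    (X (t i) \- X (t 0%N)) \+ (X (t i.+1) \- X (t i)).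
  by apply/funext => w /=; ring.
by apply: measurable_funD; [apply: IH; exact: ltnW|exact: adapted_incr].
Qed.

Hypothesis levyX : levy_process X.

Lemma past_indep (t : nat -> R) l (u : R) A B :
  0 <= t 0%N -> {homo t : i j / (i <= j)%N >-> i <= j} -> t l <= u ->
  past t l A -> measurable B ->
  P (A `&` (X u \- X (t l))%R @^-1` B) = (P A * P ((X u \- X (t l))%R @^-1` B))%E.
Proof.
move=> t0 ht tlu [C [mC ->]] mB.
(* The grid is frozen at [u] after [l], so that its last increment is the one from
   [t l] to [u]. *)
pose t' k := if (k <= l)%N then t k else u.
have t'0 : 0 <= t' 0%N by rewrite /t'.
have ht' : {homo t' : i j / (i <= j)%N >-> i <= j}.
  move=> i j ij; rewrite /t'; case: (leqP i l) => il; case: (leqP j l) => jl //.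
  - exact: ht.
  - by rewrite (le_trans _ tlu)// ht.
  - by have := leq_trans ij jl; rewrite leqNgt il.
have ind := levy_indep_increments levyX (n := l.+1) t'0 ht'.
have key D : measurable D ->
    P (\bigcap_(i in `I_l) ((X (t i.+1) \- X (t i))%R @^-1` C i) `&`
       (X u \- X (t l))%R @^-1` D) =
    (\prod_(i < l) P ((X (t i.+1) \- X (t i))%R @^-1` C i) *
       P ((X u \- X (t l))%R @^-1` D))%E.
  move=> mD.
  pose E (i : 'I_l.+1) := if (i < l)%N then C i else D.
  have mE i : measurable (E i) by rewrite /E; case: ifP.
  have tl : t' l = t l by rewrite /t' leqnn.
  have tl1 : t' l.+1 = u by rewrite /t' ltnn.
  have ti (i : nat) : (i < l)%N -> t' i = t i /\ t' i.+1 = t i.+1.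
    by move=> il; rewrite /t' il ltnW.
  have E1 : E ord_max = D by rewrite /E /= ltnn.
  have E2 (i : 'I_l) : E (widen_ord (leqnSn l) i) = C i by rewrite /E /= ltn_ord.
  have := ind E mE.
  have -> : (\prod_(i < l.+1) P ((X (t' i.+1) \- X (t' i))%R @^-1` E i) =
    \prod_(i < l) P ((X (t i.+1) \- X (t i))%R @^-1` C i) *
       P ((X u \- X (t l))%R @^-1` D))%E.
    rewrite big_ord_recr /= E1 tl tl1; congr (_ * _)%E.
    apply: eq_bigr => i _; rewrite E2.
    by have [a b] := ti i (ltn_ord i); rewrite a b.
  move=> <-; congr (P _); apply/seteqP; split => w.
    move=> [H1 H2] i _; rewrite /E; case: ifPn => il.
      by have [-> ->] := ti i il; exact: H1.
    have -> : (i = l :> nat).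
      by apply/eqP; rewrite eqn_leq -ltnS ltn_ord/= leqNgt.
    by rewrite tl tl1.
  move=> H; split.
    move=> i /= il; have := H (widen_ord (leqnSn l) (Ordinal il)) I.
    by rewrite /E /= il; have [-> ->] := ti i il.
  by have := H ord_max I; rewrite /E /= ltnn tl tl1.
rewrite key//; congr (_ * _)%E.
by have := key setT measurableT; rewrite preimage_setT setIT probability_setT mule1.
Qed.

End levy.

(** * Increments of a symmetric stable process *)

Section stable.
Context d (T : measurableType d) (R : realType) (P : probability T R).
Variables (X : R -> {RV P >-> R}) (rho c : R).
Hypotheses (rho1 : 1 <= rho) (c0 : 0 < c).
Hypothesis stableX : symmetric_stable_levy_process rho c X.

Let levyX : levy_process X. Proof. by case: stableX. Qed.

Let measurable_mul_incr b s u : measurable_fun setT (fun w => b * (X u w - X s w)).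
Proof. by apply: measurable_funM => //; exact: measurable_funB. Qed.

Lemma fine_expectation (Y : T -> R) : fine 'E_P[Y] = \int[P]_w Y w.
Proof. by rewrite expectation.unlock. Qed.

Lemma expectation_cos_incr s u b : 0 <= s -> s <= u ->
  \int[P]_w cos (b * (X u w - X s w)) = expR (- (c * (u - s) * `|b| `^ rho)).
Proof.
move=> s0 su; have us0 : 0 <= u - s by rewrite subr_ge0.
have [_ /(_ (u - s) b us0)[<- _]] := stableX.
rewrite fine_expectation.
rewrite (@eq_law_expectation _ _ _ P (X u \- X s) (X (u - s)) (fun y => cos (b * y)))//.
- move=> B mB; rewrite -(levy_stationary_increments levyX s0 us0)//.
  by rewrite addrC subrK.
- by split; [exact: measurable_cosM|exists 1 => y; exact: cos_max].
Qed.

Lemma expectation_sin_incr s u b : 0 <= s -> s <= u ->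
  \int[P]_w sin (b * (X u w - X s w)) = 0.
Proof.
move=> s0 su; have us0 : 0 <= u - s by rewrite subr_ge0.
have [_ /(_ (u - s) b us0)[_ <-]] := stableX.
rewrite fine_expectation.
rewrite (@eq_law_expectation _ _ _ P (X u \- X s) (X (u - s)) (fun y => sin (b * y)))//.
- move=> B mB; rewrite -(levy_stationary_increments levyX s0 us0)//.
  by rewrite addrC subrK.
- by split; [exact: measurable_sinM|exists 1 => y; exact: sin_max].
Qed.

Section grid.
Variable t : nat -> R.
Hypotheses (t0 : 0 <= t 0%N) (ht : {homo t : i j / (i <= j)%N >-> i <= j}).

Let t_ge0 l : 0 <= t l. Proof. by rewrite (le_trans t0)// ht. Qed.

Let tonelli_past l u (f : g_sigma_algebraType (past X t l) * R -> \bar R) :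
  t l <= u -> measurable_fun setT f -> (forall z, 0 <= f z)%E ->
  (\int[P]_w f (w, (X u w - X (t l) w)%R) =
   \int[P]_w \int[P]_w' f (w, (X u w' - X (t l) w')%R))%E.
Proof.
move=> tlu mf f0.
have GM := @past_measurable _ _ _ _ X t l.
have GI := @past_setI _ _ _ _ X t l.
have GT := @past_setT _ _ _ _ X t l.
have ind A B (pA : past X t l A) (mB : measurable B) := past_indep levyX t0 ht tlu pA mB.
exact: (tonelli_indep GM GI GT (measurable_incr X (t l) u) ind mf f0).
Qed.

(** The increment is symmetric, so that averaging it out kills the sine term of the
    addition formula and leaves its characteristic function as a factor. *)
Lemma expectation_cos_past l u b (W : T -> R) : adapted X t l W -> t l <= u ->
  \int[P]_w cos (W w + b * (X u w - X (t l) w)) =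
  \int[P]_w cos (W w) * expR (- (c * (u - t l) * `|b| `^ rho)).
Proof.
move=> aW tlu; set phi := expR _; have mW := adapted_measurable aW.
(* Adding 1 makes the integrand nonnegative, as Tonelli's theorem requires. *)
pose f (z : g_sigma_algebraType (past X t l) * R) :=
  (1 + cos (W z.1 + b * z.2))%:E.
have f0 z : (0 <= f z)%E.
  by rewrite lee_fin; have := cos_max (W z.1 + b * z.2); rewrite ler_norml => /andP[]; lra.
have mf : measurable_fun setT f.
  apply/measurable_EFinP; apply: measurable_funD => //; apply: measurableT_comp.
    by apply: continuous_measurable_fun; exact: continuous_cos.
  by apply: measurable_funD; [exact: measurableT_comp|apply: measurable_funM].
have bcW : bounded_mfun (fun w => cos (W w)) by exact: bounded_mfun_cos.
have b1 : bounded_mfun (fun _ : T => 1 : R) by exact: bounded_mfun_cst.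
have bWX : bounded_mfun (fun w => cos (W w + b * (X u w - X (t l) w))).
  by apply: bounded_mfun_cos; exact: measurable_funD.
have := tonelli_past tlu mf f0; rewrite /f /=.
under [X in _ = X -> _]eq_integral => w _.
  have bc : bounded_mfun (fun w' => cos (b * (X u w' - X (t l) w'))).
    exact: bounded_mfun_cos.
  have bs : bounded_mfun (fun w' => sin (b * (X u w' - X (t l) w'))).
    exact: bounded_mfun_sin.
  under eq_integral do rewrite cosD.
  rewrite EFin_Rintegral; last first.
    by apply: bounded_mfunD => //; apply: bounded_mfunB; exact: bounded_mfunZ.
  rewrite expectation_addr//; last by apply: bounded_mfunB; exact: bounded_mfunZ.
  rewrite expectation_subr; [|exact: bounded_mfunZ..].
  rewrite !expectation_mulr// expectation_cos_incr// expectation_sin_incr//.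
  rewrite expectation_const mulr0 subr0 -/phi mulrC; over.
rewrite /= !EFin_Rintegral; last first.
- exact: bounded_mfunD.
- by apply: bounded_mfunD => //; exact: bounded_mfunZ.
rewrite !expectation_addr//; last exact: bounded_mfunZ.
by rewrite expectation_mulr// => -[/addrI ->]; rewrite mulrC.
Qed.

Lemma expectation_cos_grid_ge0 (b : nat -> R) n :
  0 <= \int[P]_w cos (\sum_(i < n) b i * (X (t i.+1) w - X (t i) w)).
Proof.
elim: n => [|n IH].
  under eq_Rintegral do rewrite big_ord0 cos0.
  by rewrite expectation_const.
under eq_Rintegral do rewrite big_ord_recr /=.
rewrite expectation_cos_past; last exact: ht.
  by rewrite mulr_ge0 ?expR_ge0.
apply: measurable_sum => i _; apply: measurable_funM => //.
exact: adapted_incr.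
Qed.

(** The bound on the density of the increment from [t l] to [u] holds whatever the
    past, which only shifts the argument of the kernel. *)
Lemma expectation_heat_kernel_past eps l u (Z : T -> R) : 0 < eps ->
  t l < u -> adapted X t l Z -> bounded_mfun Z -> (forall w, 0 <= Z w) ->
  \int[P]_w (Z w * heat_kernel eps (X u w - X (t 0%N) w)) <=
  expR 1 / pi * (c * (u - t l)) `^ (- rho^-1) * \int[P]_w Z w.
Proof.
move=> e0 tlu aZ bZ Z0; set K := expR 1 / pi * _.
pose U := X (t l) \- X (t 0%N).
have aU : adapted X t l U by exact: adapted_incr0.
pose f (z : g_sigma_algebraType (past X t l) * R) :=
  (Z z.1 * heat_kernel eps (U z.1 + z.2))%:E.
have f0 z : (0 <= f z)%E by rewrite lee_fin mulr_ge0// heat_kernel_ge0.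
have mf : measurable_fun setT f.
  apply/measurable_EFinP; apply: measurable_funM; first exact: measurableT_comp.
  apply: measurableT_comp.
    by apply: continuous_measurable_fun; exact: continuous_heat_kernel.
  by apply: measurable_funD => //; exact: measurableT_comp.
have := tonelli_past (ltW tlu) mf f0; rewrite /f /=.
have K0 : 0 <= K by rewrite mulr_ge0 ?powR_ge0// divr_ge0 ?expR_ge0// pi_ge0.
have bh : bounded_mfun (fun w => heat_kernel eps (X u w - X (t 0%N) w)).
  by apply: bounded_mfun_heat_kernel => //; exact: measurable_funB.
have -> : (fun w => (Z w * heat_kernel eps (U w + (X u w - X (t l) w)))%:E) =
    (fun w => (Z w * heat_kernel eps (X u w - X (t 0%N) w))%:E).
  by apply/funext => w; rewrite /U /= addrC subrKA.
rewrite EFin_Rintegral; last exact: bounded_mfunM.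
move=> H; rewrite -lee_fin H -expectation_mulr// -EFin_Rintegral; last exact: bounded_mfunZ.
apply: ge0_le_integral => //.
- by move=> w _; apply: integral_ge0 => w' _; exact: (f0 (w, _)).
- apply: (@measurable_fun_sub_sigma _ _ _ (@past_measurable _ _ _ _ X t l)).
  apply: (@measurable_fun_fubini_tonelli_F _ _ _ _ _ P
    (fun z : g_sigma_algebraType (past X t l) * T =>
       f (z.1, X u z.2 - X (t l) z.2))) => //.
  apply: measurableT_comp => //; apply: measurable_fun_pair => //.
  by apply: (measurableT_comp (measurable_incr X (t l) u)).
- by apply/measurable_EFinP; case: (bounded_mfunZ K bZ).
move=> w _.
have bhx x : bounded_mfun (fun w' => heat_kernel eps (x + (X u w' - X (t l) w'))).
  apply: bounded_mfun_heat_kernel => //; apply: measurable_funD => //.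
  exact: measurable_funB.
rewrite EFin_Rintegral; last exact: bounded_mfunZ.
rewrite expectation_mulr// lee_fin mulrC ler_wpM2r//.
apply: (@stable_heat_kernel_le R _ _ P eps _ _ (U w) (X u \- X (t l))) => //.
- by rewrite mulr_gt0// subr_gt0.
- by move=> b; rewrite expectation_cos_incr// ltW.
- by move=> b; rewrite expectation_sin_incr// ltW.
Qed.

End grid.

Let grid4 (a0 a1 a2 a3 : R) (k : nat) : R :=
  match k with 0 => a0 | 1 => a1 | 2 => a2 | _ => a3 end.

Let grid4_homo a0 a1 a2 a3 : a0 <= a1 -> a1 <= a2 -> a2 <= a3 ->
  {homo grid4 a0 a1 a2 a3 : i j / (i <= j)%N >-> i <= j}.
Proof.
move=> h1 h2 h3; have h02 := le_trans h1 h2; have h13 := le_trans h2 h3.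
have h03 := le_trans h02 h3.
by move=> [|[|[|i]]] [|[|[|j]]].
Qed.

Let expectation_cos4_ge0 a0 a1 a2 a3 b0 b1 b2 :
  0 <= a0 -> a0 <= a1 -> a1 <= a2 -> a2 <= a3 ->
  0 <= \int[P]_w cos (b0 * (X a1 w - X a0 w) + b1 * (X a2 w - X a1 w) +
                      b2 * (X a3 w - X a2 w)).
Proof.
move=> h0 h1 h2 h3.
have := @expectation_cos_grid_ge0 (grid4 a0 a1 a2 a3) h0 (grid4_homo h1 h2 h3)
  (grid4 b0 b1 b2 0) 3.
by under eq_Rintegral do rewrite 3!big_ord_recr big_ord0 /= add0r.
Qed.

(** Positive-definiteness: after sorting the four times, a combination of two
    increments is one of three consecutive independent symmetric increments. *)
Lemma expectation_cos_incr2_ge0 r s r' s' a b :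
  0 <= r -> 0 <= s -> 0 <= r' -> 0 <= s' ->
  0 <= \int[P]_w cos (a * (X r w - X s w) + b * (X r' w - X s' w)).
Proof.
wlog sr : r s a / s <= r.
  move=> H r0 s0 r'0 s'0; have [sr|rs] := leP s r; first exact: H.
  have := H s r (- a) (ltW rs) s0 r0 r'0 s'0.
  by under eq_Rintegral do rewrite mulNr -mulrN opprB.
wlog sr' : r' s' b / s' <= r'.
  move=> H r0 s0 r'0 s'0; have [sr'|rs'] := leP s' r'; first exact: H.
  have := H s' r' (- b) (ltW rs') r0 s0 s'0 r'0.
  by under eq_Rintegral do rewrite mulNr -mulrN opprB.
wlog ss' : r s r' s' a b sr sr' / s <= s'.
  move=> H r0 s0 r'0 s'0; have [ss'|ss'] := leP s s'; first exact: H.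
  have := H r' s' r s b a sr' sr (ltW ss') r'0 s'0 r0 s0.
  by under eq_Rintegral do rewrite addrC.
move=> r0 s0 r'0 s'0; have [rs'|s'r] := leP r s'.
  have := expectation_cos4_ge0 a 0 b s0 sr rs' sr'.
  by under eq_Rintegral do rewrite mul0r addr0.
have [rr'|r'r] := leP r r'.
  have := expectation_cos4_ge0 a (a + b) b s0 ss' (ltW s'r) rr'.
  rewrite (_ : (fun w => cos (_ + _ + _)) =
    (fun w => cos (a * (X r w - X s w) + b * (X r' w - X s' w))))//.
  by apply/funext => w; congr cos; ring.
have := expectation_cos4_ge0 a (a + b) a s0 ss' sr' (ltW r'r).
rewrite (_ : (fun w => cos (_ + _ + _)) =
  (fun w => cos (a * (X r w - X s w) + b * (X r' w - X s' w))))//.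
by apply/funext => w; congr cos; ring.
Qed.

Lemma expectation_cos_cos_ge0 r s r' s' a b :
  0 <= r -> 0 <= s -> 0 <= r' -> 0 <= s' ->
  0 <= \int[P]_w (cos ((X r w - X s w) * a) * cos ((X r' w - X s' w) * b)).
Proof.
move=> r0 s0 r'0 s'0.
have h1 := expectation_cos_incr2_ge0 a b r0 s0 r'0 s'0.
have h2 := expectation_cos_incr2_ge0 a (- b) r0 s0 r'0 s'0.
have bb a' b' : bounded_mfun (fun w => cos (a' * (X r w - X s w) + b' * (X r' w - X s' w))).
  by apply: bounded_mfun_cos; exact: measurable_funD.
rewrite (_ : (fun w => _) = (fun w => 2^-1 *
   (cos (a * (X r w - X s w) + b * (X r' w - X s' w)) +
    cos (a * (X r w - X s w) + (- b) * (X r' w - X s' w))))); last first.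
  apply/funext => w; rewrite !cosD mulNr cosN sinN !(mulrC _ a) !(mulrC _ b).
  lra.
rewrite expectation_mulr; last exact: bounded_mfunD.
by rewrite expectation_addr// mulr_ge0// addr_ge0.
Qed.

Let heat_kernel2_nincr r s r' s' e1 e2 e' :
  0 <= r -> 0 <= s -> 0 <= r' -> 0 <= s' -> 0 < e1 -> e1 <= e2 -> 0 < e' ->
  \int[P]_w (heat_kernel e' (X r' w - X s' w) * heat_kernel e2 (X r w - X s w)) <=
  \int[P]_w (heat_kernel e' (X r' w - X s' w) * heat_kernel e1 (X r w - X s w)).
Proof.
move=> r0 s0 r'0 s'0 e10 e12 e'0.
have mB u v : measurable_fun setT (fun w => X u w - X v w) by exact: measurable_funB.
apply: (@expectation_heat_kernel_nincr _ _ _ P e1 e2) => //.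
  exact: bounded_mfun_heat_kernel.
move=> y; under eq_Rintegral do rewrite mulrC.
apply: (@expectation_heat_kernel_ge0 _ _ _ P e') => //.
  by apply: bounded_mfun_cos; exact: measurable_funM.
by move=> y'; exact: expectation_cos_cos_ge0.
Qed.

(** The two widths are changed in turn; the kernel that stays is itself a positive
    superposition of cosines, which keeps the relevant expectations nonnegative. *)
Lemma expectation_heat_kernel2_nincr r s r' s' e1 e2 e1' e2' :
  0 <= r -> 0 <= s -> 0 <= r' -> 0 <= s' ->
  0 < e1 -> e1 <= e2 -> 0 < e1' -> e1' <= e2' ->
  \int[P]_w (heat_kernel e2 (X r w - X s w) * heat_kernel e2' (X r' w - X s' w)) <=
  \int[P]_w (heat_kernel e1 (X r w - X s w) * heat_kernel e1' (X r' w - X s' w)).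
Proof.
move=> r0 s0 r'0 s'0 e10 e12 e10' e12'.
apply: (@le_trans _ _ (\int[P]_w (heat_kernel e2 (X r w - X s w) *
    heat_kernel e1' (X r' w - X s' w)))).
  by apply: heat_kernel2_nincr => //; exact: lt_le_trans e12.
under eq_Rintegral do rewrite mulrC.
under [leRHS]eq_Rintegral do rewrite mulrC.
exact: heat_kernel2_nincr.
Qed.

End stable.

(** * Power sums *)

Section sums.
Context {R : realType}.

Lemma ler_sum_ord (F : nat -> R) (n N : nat) : (n <= N)%N -> (forall i, 0 <= F i) ->
  \sum_(i < n) F i <= \sum_(i < N) F i.
Proof.
move=> nN F0; rewrite -!(big_mkord xpredT F) (big_cat_nat (leq0n n) nN)/=.
by rewrite lerDl sumr_ge0.
Qed.

(** The exponential of a sum loses its terms one at a time, from the left; the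
    increments factor into a first term and an exponential of the later ones. *)
Lemma expR_sum_telescope (x : nat -> R) (m N : nat) :
  expR (\sum_(m <= i < N) x i) =
  1 + \sum_(m <= i < N) (expR (x i) - 1) * expR (\sum_(i.+1 <= k < N) x k).
Proof.
move nE : (N - m)%N => n; elim: n m nE => [|n IH] m nE.
  by rewrite !big_geq ?expR0 ?addr0// -subn_eq0 nE.
have mN : (m < N)%N by rewrite -subn_gt0 nE.
rewrite [in LHS]big_ltn// [in RHS]big_ltn// expRD.
have {}IH := IH m.+1; rewrite subnS nE in IH; have {}IH := IH erefl.
set E := expR (\sum_(_ <= _ < _) _) in IH *.
have -> : expR (x m) * E = (expR (x m) - 1) * E + E by ring.
by rewrite {2}IH addrCA.
Qed.

Lemma expR_sub1_le (x : R) : 0 <= x -> x <= 2^-1 -> expR x - 1 <= 2 * x.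
Proof.
move=> x0 x1; have h : 1 - x <= expR (- x) by exact: expR_ge1Dx.
have y0 := expR_gt0 x; have e : expR x * expR (- x) = 1 by rewrite expRxMexpNx_1.
nra.
Qed.

Lemma powR_nincr (a x y : R) : a <= 0 -> 0 < x -> x <= y -> y `^ a <= x `^ a.
Proof.
move=> a0 x0 xy; have y0 : 0 < y by exact: lt_le_trans xy.
have e z : z `^ a = (z `^ (- a))^-1 by rewrite -powRN opprK.
rewrite !e lef_pV2 ?posrE ?powR_gt0//.
by apply: ge0_ler_powR; rewrite ?nnegrE ?oppr_ge0// ltW.
Qed.

(** Bernoulli's inequality for an exponent at most one, from the weighted
    inequality between arithmetic and geometric means. *)
Lemma powR_le_tangent (d u : R) : 0 < d -> d <= 1 -> 0 <= u -> u <= 1 ->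
  (1 - u) `^ d <= 1 - d * u.
Proof.
move=> d0 d1 u0 u1.
have [->|ud] := eqVneq u 1.
  by rewrite subrr powR0 ?gt_eqF// mulr1 subr_ge0.
have v0 : 0 < 1 - u by rewrite subr_gt0 lt_neqAle ud.
have [->|dn1] := eqVneq d 1; first by rewrite powRr1 ?mul1r// ltW.
have d1' : 0 < 1 - d by rewrite subr_gt0 lt_neqAle dn1.
have := @conjugate_powR R ((1 - u) `^ d) 1 d^-1 (1 - d)^-1 (powR_ge0 _ _) ler01.
rewrite !invr_gt0 => /(_ d0 d1'); rewrite !invrK => /(_ (subrKC _ _)).
rewrite mulr1 -powRrM mulfV ?gt_eqF// powRr1 ?(ltW v0)// powR1.
lra.
Qed.

(** Comparison with the integral of a power over the unit interval: the tangent
    inequality at [1 - 1 / k] makes the partial sums telescope. *)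
Lemma sum_powR_le (d : R) (N : nat) : 0 < d -> d <= 1 ->
  \sum_(m < N) (N%:R)^-1 * (m.+1%:R / N%:R) `^ (d - 1) <= d^-1 :> R.
Proof.
move=> d0 d1; case: N => [|n]; first by rewrite big_ord0 invr_ge0 ltW.
set N := n.+1.
have N0 : 0 < N%:R :> R by rewrite ltr0n.
suff H : forall k, \sum_(m < k) (N%:R)^-1 * (m.+1%:R / N%:R) `^ (d - 1) <=
    d^-1 * (k%:R / N%:R) `^ d :> R.
  by have := H N; rewrite divff ?gt_eqF// powR1 mulr1.
elim=> [|k IH]; first by rewrite big_ord0 mulr_ge0 ?powR_ge0// invr_ge0 ltW.
rewrite big_ord_recr /=.
apply: le_trans (lerD IH (lexx _)) _.
set y : R := k.+1%:R / N%:R.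
have y0 : 0 < y by rewrite divr_gt0// ltr0n.
have k10 : 0 < k.+1%:R :> R by rewrite ltr0n.
pose u : R := (k.+1%:R)^-1.
have kE : k%:R / N%:R = y * (1 - u).
  by rewrite /y /u -natr1; field; rewrite (gt_eqF N0) natr1 gt_eqF.
have u01 : 0 <= u /\ u <= 1.
  by rewrite /u invr_ge0 ler0n; split=> //; rewrite invf_le1// ler1n.
rewrite kE powRM ?subr_ge0 ?u01.2// ?(ltW y0)//.
have hT := powR_le_tangent d0 d1 u01.1 u01.2.
have yd : y `^ (d - 1) = y `^ d / y by rewrite powRB ?powRr1 ?(ltW y0)//; apply/implyP => _; rewrite gt_eqF.
have Nu : (N%:R)^-1 = y * u by rewrite /y /u mulrAC divff ?gt_eqF// mul1r.
rewrite yd Nu; have yp := powR_gt0 d y0.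
have -> : y * u * (y `^ d / y) = u * y `^ d by field; rewrite gt_eqF.
have : d^-1 * (y `^ d * (1 - u) `^ d) <= d^-1 * (y `^ d * (1 - d * u)).
  by rewrite ler_wpM2l ?invr_ge0 ?(ltW d0)// ler_wpM2l// ltW.
have -> : d^-1 * (y `^ d * (1 - d * u)) = d^-1 * y `^ d - u * y `^ d.
  by field; rewrite gt_eqF.
lra.
Qed.

(** Exponential damping makes the Riemann sums of an integrable power
    uniformly small, because [expR (- y) <= y `^ (- d / 2)]. *)
Lemma sum_powR_expR_small (d B : R) : 0 < d -> d <= 1 -> 0 <= B ->
  exists2 lam : R, 0 <= lam & forall N,
  \sum_(m < N) (B / N%:R * (m.+1%:R / N%:R) `^ (d - 1)) *
     expR (- (lam / N%:R)) ^+ m.+1 <= 4^-1.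
Proof.
move=> d0 d1 B0; pose h := d / 2.
have h0 : 0 < h by rewrite divr_gt0.
have h1 : h <= 1 by rewrite /h; lra.
pose C := 4 * (B + 1) / h.
have C0 : 0 < C by rewrite divr_gt0// mulr_gt0// ltr_wpDl.
pose lam := C `^ h^-1.
have lam0 : 0 < lam by exact: powR_gt0.
exists lam; first exact: ltW.
move=> [|n]; first by rewrite big_ord0.
set N := n.+1; have N0 : 0 < N%:R :> R by rewrite ltr0n.
have lamh : lam `^ (- h) = C^-1.
  by rewrite /lam -powRrM mulrN mulVf ?gt_eqF// powR_inv1// ltW.
have term (m : 'I_N) :
    (B / N%:R * (m.+1%:R / N%:R) `^ (d - 1)) * expR (- (lam / N%:R)) ^+ m.+1 <=
    (B / C) * ((N%:R)^-1 * (m.+1%:R / N%:R) `^ (h - 1)).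
  set x : R := m.+1%:R / N%:R.
  have x0 : 0 < x by rewrite divr_gt0// ltr0n.
  have -> : expR (- (lam / N%:R)) ^+ m.+1 = expR (- (lam * x)).
    by rewrite -expRM_natl; congr expR; rewrite /x mulrN mulrCA mulrA.
  have lx0 : 0 < lam * x by rewrite mulr_gt0.
  have e1 : expR (- (lam * x)) <= (lam * x) `^ (- h).
    rewrite expRN powRN lef_pV2 ?posrE ?expR_gt0 ?powR_gt0//.
    have [l1|l1] := leP (lam * x) 1.
      apply: (@le_trans _ _ 1).
      by rewrite -(powRr0 (lam * x)) ger_powR ?lx0// ltW.
      by rewrite -[leLHS]expR0 ler_expR ltW.
    apply: (@le_trans _ _ (lam * x)).
      by rewrite -[leRHS]powRr1 ?ler_powR// ltW.
    by apply: le_trans (expR_ge1Dx _); rewrite lerDr.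
  rewrite powRM ?(ltW lam0) ?(ltW x0)// lamh in e1.
  have xE : x `^ (h - 1) = x `^ (d - 1) * x `^ (- h).
    by rewrite -powRD; [congr powR; rewrite /h; field|apply/implyP => _; rewrite gt_eqF].
  rewrite xE.
  have -> : B / C * ((N%:R)^-1 * (x `^ (d - 1) * x `^ (- h))) =
    B / N%:R * x `^ (d - 1) * (C^-1 * x `^ (- h)) by ring.
  by rewrite ler_wpM2l// mulr_ge0 ?powR_ge0// divr_ge0// ltW.
apply: le_trans (ler_sum _ (fun m _ => term m)) _.
rewrite -mulr_sumr.
apply: (@le_trans _ _ (B / C * h^-1)).
  apply: ler_wpM2l; first by rewrite divr_ge0// ltW.
  exact: (sum_powR_le N h0 h1).
rewrite /C (_ : _ / _ / _ = B / (4 * (B + 1))); last by field; rewrite !gt_eqF// ltr_wpDl.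
by rewrite ler_pdivrMr ?mulr_gt0 ?ltr_wpDl//; lra.
Qed.

End sums.

(** * A discrete Khasminskii lemma *)

Section khasminskii.
Context d (T : measurableType d) (R : realType) (P : probability T R).
Variables (a : nat -> T -> R) (M : nat -> (T -> R) -> Prop) (N : nat).
Variables (kap : nat -> R) (q : R).
Hypothesis Mb : forall l Z, M l Z -> bounded_mfun Z /\ forall w, 0 <= Z w.
Hypothesis a_ge0 : forall i w, 0 <= a i w.
Hypothesis a_le : forall i w, a i w <= 2^-1.
Hypothesis ba : forall i, bounded_mfun (a i).
Hypothesis Mstep : forall l i Z, M l Z -> (l < i < N)%N ->
  M i (fun w => Z w * (expR (a i w) - 1)).
Hypothesis Ea : forall l i Z, M l Z -> (l < i < N)%N ->
  \int[P]_w (Z w * a i w) <= kap (i - l) * \int[P]_w Z w.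
Hypotheses (q0 : 0 < q) (q1 : q <= 1) (kap0 : forall m, 0 <= kap m).
Hypothesis kap_small : \sum_(m < N) kap m.+1 * q ^+ m.+1 <= 4^-1.

(** Discrete form of Khasminskii's lemma, in which [q] plays the role of an
    exponential discount in time; [M l] stands for the nonnegative bounded
    variables that are known at time [l].  Expanding the exponential of the sum and
    bounding [expR x - 1] by [2 * x] reduces the estimate at [l] to the estimates at
    the later times, the increment up to each of them having a small expectation. *)
Lemma khasminskii l Z : M l Z -> (l <= N)%N ->
  \int[P]_w (Z w * expR (\sum_(l.+1 <= i < N) a i w)) <=
  2 * q^-1 ^+ (N - l) * \int[P]_w Z w.
Proof.
have b_exp l' : bounded_mfun (fun w => expR (\sum_(l' <= k < N) a k w)).
  by apply: bounded_mfun_expR; exact: bounded_mfun_sum.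
have b1 : bounded_mfun (fun _ : T => 1 : R) by exact: bounded_mfun_cst.
move nE : (N - l)%N => n; move: n {-2}n (leqnn n) l Z nE.
elim=> [|n IH] k kn l Z kE MZ lN.
  have kE0 : k = 0%N by apply/eqP; rewrite -leqn0.
  have [bZ Z0] := Mb MZ.
  have NE : (N <= l.+1)%N by rewrite leqW// -subn_eq0 kE kE0.
  rewrite kE0 expr0 mulr1; under eq_Rintegral do rewrite big_geq// expR0 mulr1.
  by rewrite mulr2n mulrDl mul1r lerDl; apply: Rintegral_ge0 => w _.
have [bZ Z0] := Mb MZ.
have EZ0 : 0 <= \int[P]_w Z w by exact: Rintegral_ge0.
pose W i w := Z w * (expR (a i w) - 1).
have bW i : bounded_mfun (W i).
  by apply: bounded_mfunM => //; apply: bounded_mfunB => //; exact: bounded_mfun_expR.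
have -> : (fun w => Z w * expR (\sum_(l.+1 <= i < N) a i w)) =
    (fun w => Z w + \sum_(l.+1 <= i < N) W i w * expR (\sum_(i.+1 <= j < N) a j w)).
  apply/funext => w; rewrite expR_sum_telescope mulrDr mulr1 mulr_sumr.
  by congr (_ + _); apply: eq_bigr => i _; rewrite mulrA.
have bWe i : bounded_mfun (fun w => W i w * expR (\sum_(i.+1 <= j < N) a j w)).
  exact: bounded_mfunM.
rewrite expectation_addr//; last exact: bounded_mfun_sum.
rewrite expectation_sumr//.
have Q1 : 1 <= q^-1 by rewrite invf_ge1.
have Q0 : 0 <= q^-1 by rewrite invr_ge0 ltW.
have step i : (l < i < N)%N ->
   \int[P]_w (W i w * expR (\sum_(i.+1 <= j < N) a j w)) <=
   4 * q^-1 ^+ k * (kap (i - l) * q ^+ (i - l)) * \int[P]_w Z w.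
  move=> liN; have MW : M i (W i) by exact: Mstep MZ liN.
  have /andP[li iN] := liN.
  have ikn : (N - i <= n)%N.
    by rewrite -ltnS (leq_trans _ kn)// -kE ltn_sub2l// (ltn_trans li).
  apply: le_trans (IH _ ikn i _ erefl MW (ltnW iN)) _.
  have kE' : k = (N - i + (i - l))%N by rewrite -kE addnBA ?subnK// ltnW.
  have this : q^-1 ^+ k * (kap (i - l) * q ^+ (i - l)) = q^-1 ^+ (N - i) * kap (i - l).
    rewrite kE' exprD.
    rewrite (_ : _ * _ = q^-1 ^+ (N - i) * kap (i - l) *
      (q^-1 ^+ (i - l) * q ^+ (i - l))); last by ring.
    by rewrite -exprMn mulVf ?gt_eqF// expr1n mulr1.
  rewrite -(mulrA 4) this.
  have W2 w : W i w <= 2 * (Z w * a i w).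
    by rewrite /W mulrCA ler_wpM2l// expR_sub1_le.
  have EW : \int[P]_w W i w <= 2 * (kap (i - l) * \int[P]_w Z w).
    apply: (@le_trans _ _ (\int[P]_w (2 * (Z w * a i w)))).
      by apply: le_expectation => //; apply: bounded_mfunZ; exact: bounded_mfunM.
    rewrite expectation_mulr ?ler_wpM2l//; last exact: bounded_mfunM.
    exact: Ea.
  apply: le_trans (ler_wpM2l _ EW) _; first by rewrite mulr_ge0// exprn_ge0.
  by apply: eq_ler; ring.
have sumle : \sum_(l.+1 <= i < N) kap (i - l) * q ^+ (i - l) <= 4^-1.
  apply: le_trans kap_small.
  rewrite -(add0n l.+1) big_addn big_mkord.
  under eq_bigr => i _ do rewrite -addSnnS addnK.
  apply: (ler_sum_ord (F := fun m => kap m.+1 * q ^+ m.+1)); first exact: leq_subr.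
  by move=> m; rewrite mulr_ge0// exprn_ge0// ltW.
apply: (@le_trans _ _ (\int[P]_w Z w + q^-1 ^+ k * \int[P]_w Z w)).
  rewrite lerD2l.
  apply: (@le_trans _ _ (\sum_(l.+1 <= i < N)
      (4 * q^-1 ^+ k * \int[P]_w Z w) * (kap (i - l) * q ^+ (i - l)))).
    rewrite big_nat_cond [leRHS]big_nat_cond; apply: ler_sum => i /andP[/step h _].
    by apply: le_trans h _; apply: eq_ler; ring.
  rewrite -mulr_sumr.
  apply: le_trans (ler_wpM2l _ sumle) _.
    by rewrite mulr_ge0// mulr_ge0// exprn_ge0.
  by apply: eq_ler; field.
have Qk : 1 <= q^-1 ^+ k by rewrite exprn_ege1.
nra.
Qed.

End khasminskii.

(** * Exponential moments for a fixed starting time *)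

Section riemann_sums.
Context d (T : measurableType d) (R : realType) (P : probability T R).
Variables (X : R -> {RV P >-> R}) (rho c a : R).
Hypotheses (rho1 : 1 <= rho) (c0 : 0 < c) (a0 : a <= 0).
Hypothesis a_rho : 0 < a - rho^-1 + 1.
Hypothesis stableX : symmetric_stable_levy_process rho c X.

Let rho0 : 0 < rho. Proof. exact: lt_le_trans rho1. Qed.

(** Given the past at time [l], the kernel at time [i] costs
    [((i - l) / N) `^ (- rho^-1)], and since [a <= 0] the weight at [i] is at most
    the weight at [i - l].  Khasminskii's lemma thus faces Riemann sums of the power
    [a - rho^-1], which is integrable at the origin.  The side condition asks each
    term of the sum to be small, which fine grids ensure. *)
Lemma expectation_exp_sum_le (b : R) : 0 <= b ->
  exists2 K : R, 0 <= K & forall eps n j, 0 < eps ->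
    b / n.+1%:R * (n.+1%:R)^-1 `^ a * heat_peak eps <= 2^-1 ->
    \int[P]_w expR (\sum_(1 <= i < n.+1) b / n.+1%:R * (i.+1%:R / n.+1%:R) `^ a *
      heat_kernel eps (X ((j + i).+1%:R / n.+1%:R) w - X (j.+1%:R / n.+1%:R) w)) <= K.
Proof.
move=> b0; pose d' := a - rho^-1 + 1.
have d'1 : d' <= 1 by rewrite /d' gerDr subr_le0 (le_trans a0)// invr_ge0 ltW.
pose B := b * (expR 1 / pi * c `^ (- rho^-1)).
have p0 := pi_gt0 R.
have B0 : 0 <= B by rewrite !mulr_ge0 ?powR_ge0 ?expR_ge0// invr_ge0 ltW.
have [lam lam0 small] := sum_powR_expR_small a_rho d'1 B0.
exists (2 * expR lam); first by rewrite mulr_ge0// expR_ge0.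
move=> eps n j e0 pk; set N := n.+1.
have N0 : 0 < N%:R :> R by rewrite ltr0n.
pose t k : R := (j + k).+1%:R / N%:R.
have t0 : 0 <= t 0%N by rewrite divr_ge0// ltW.
have ht : {homo t : i j / (i <= j)%N >-> i <= j}.
  by move=> i k ik; rewrite ler_wpM2r ?invr_ge0 ?(ltW N0)// ler_nat ltnS leq_add2l.
pose q := expR (- (lam / N%:R)).
have q0 : 0 < q by exact: expR_gt0.
have q1 : q <= 1.
  by rewrite -[leRHS]expR0 ler_expR oppr_le0 divr_ge0// ltW.
pose av i w := b / N%:R * (i.+1%:R / N%:R) `^ a * heat_kernel eps (X (t i) w - X (t 0%N) w).
have bN : 0 <= b / N%:R by rewrite divr_ge0// ltW.
pose kap m : R := B / N%:R * (m%:R / N%:R) `^ (d' - 1).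
pose M l (Z : T -> R) := [/\ adapted X t l Z, bounded_mfun Z & forall w, 0 <= Z w].
have av0 i w : 0 <= av i w by rewrite !mulr_ge0 ?powR_ge0// heat_kernel_ge0.
have ale i w : av i w <= 2^-1.
  apply: le_trans pk; rewrite /av -!mulrA ler_wpM2l// mulrA.
  rewrite -mulrA ler_wpM2l ?invr_ge0 ?(ltW N0)//.
  apply: ler_pM; rewrite ?powR_ge0 ?heat_kernel_ge0 ?heat_kernel_le//.
  apply: powR_nincr => //.
  by rewrite -[leLHS]mul1r ler_wpM2r ?invr_ge0 ?(ltW N0)// ler1n.
have bav i : bounded_mfun (av i).
  apply: bounded_mfunZ; apply: bounded_mfun_heat_kernel => //.
  exact: measurable_funB.
have Mb l Z : M l Z -> bounded_mfun Z /\ forall w, 0 <= Z w by case.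
have Mstep l i Z : M l Z -> (l < i < N)%N -> M i (fun w => Z w * (expR (av i w) - 1)).
  move=> [aZ bZ Z0] /andP[li iN]; split.
  - apply: measurable_funM; first exact: adapted_sub (ltnW li) aZ.
    apply: measurable_funB => //; apply: measurableT_comp => //.
    apply: measurable_funM => //; apply: measurableT_comp.
      by apply: continuous_measurable_fun; exact: continuous_heat_kernel.
    exact: adapted_incr0.
  - apply: bounded_mfunM => //; apply: bounded_mfunB; last exact: bounded_mfun_cst.
    exact: bounded_mfun_expR.
  - move=> w; rewrite mulr_ge0// subr_ge0 -expR0 ler_expR//.
have Ea l i Z : M l Z -> (l < i < N)%N ->
    \int[P]_w (Z w * av i w) <= kap (i - l)%N * \int[P]_w Z w.
  move=> [aZ bZ Z0] /andP[li iN].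
  have il0 : 0 < (i - l)%:R :> R by rewrite ltr0n subn_gt0.
  have tl : t i - t l = (i - l)%:R / N%:R.
    by rewrite /t -mulrBl natrB ?(ltnW li)// -!addnS !natrD; congr (_ / _); rewrite -!natr1; ring.
  have tlt : t l < t i by rewrite -subr_gt0 tl divr_gt0.
  have EZ0 : 0 <= \int[P]_w Z w by exact: Rintegral_ge0.
  have h := expectation_heat_kernel_past rho1 c0 stableX t0 ht e0 tlt aZ bZ Z0.
  have bZh : bounded_mfun (fun w => Z w * heat_kernel eps (X (t i) w - X (t 0%N) w)).
    apply: bounded_mfunM => //; apply: bounded_mfun_heat_kernel => //.
    exact: measurable_funB.
  have -> : (fun w => Z w * av i w) = (fun w => b / N%:R * (i.+1%:R / N%:R) `^ a *
      (Z w * heat_kernel eps (X (t i) w - X (t 0%N) w))).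
    by apply/funext => w; rewrite /av mulrCA.
  rewrite expectation_mulr//.
  have W0 : 0 <= b / N%:R * (i.+1%:R / N%:R) `^ a by rewrite mulr_ge0 ?powR_ge0.
  apply: le_trans (ler_wpM2l W0 h) _.
  set x := (i - l)%:R / N%:R in tl.
  have x0 : 0 < x by rewrite divr_gt0.
  have wle : (i.+1%:R / N%:R) `^ a <= x `^ a.
    apply: powR_nincr => //; rewrite ler_wpM2r ?invr_ge0 ?(ltW N0)// ler_nat.
    exact: leq_trans (leq_subr _ _) _.
  rewrite tl powRM ?(ltW c0) ?(ltW x0)//.
  have -> : kap (i - l)%N = b / N%:R * x `^ a * (expR 1 / pi * (c `^ (- rho^-1) * x `^ (- rho^-1))).
    rewrite /kap -/x /B /d' addrK powRD; last by apply/implyP => _; rewrite gt_eqF.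
    ring.
  rewrite [leLHS]mulrA; apply: ler_wpM2r => //; apply: ler_wpM2r; last exact: ler_wpM2l.
  by rewrite mulr_ge0 ?divr_ge0 ?expR_ge0 ?(ltW p0)// mulr_ge0 ?powR_ge0.
have M1 : M 0%N (fun=> 1).
  by split=> //; [exact: measurable_cst|exact: bounded_mfun_cst].
have kap0 m : 0 <= kap m by rewrite mulr_ge0 ?powR_ge0// divr_ge0// ltW.
have ks : \sum_(m < N) kap m.+1 * q ^+ m.+1 <= 4^-1 by exact: small.
have := khasminskii Mb av0 ale bav Mstep Ea q0 q1 kap0 ks M1 (leq0n N).
rewrite expectation_const mulr1 subn0 /q -expRN opprK -expRM_natl.
rewrite mulrCA divff ?mulr1 ?gt_eqF//.
under eq_Rintegral do rewrite mul1r.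
rewrite /av /t; under [in X in X -> _]eq_Rintegral do under eq_bigr do rewrite addn0.
by [].
Qed.

End riemann_sums.

(** * Riemann sums of the self-intersection functional *)

Section riemann_silt.
Context {R : realType}.
Variable a : R.
Hypothesis a0 : a <= 0.

Lemma average_const n (x : R) : (n.+1%:R)^-1 * \sum_(i < n.+1) x = x.
Proof. by rewrite sumr_const card_ord -[x *+ _]mulr_natl mulKf// pnatr_eq0. Qed.

Lemma sum_gt_ord_le (N i : nat) (f : nat -> R) : (i < N)%N -> (forall j, 0 <= f j) ->
  \sum_(j < N | (i < j)%N) f j <= \sum_(1 <= m < N) f (i + m)%N.
Proof.
move=> iN f0; rewrite -(big_mkord (fun j => (i < j)%N) f).
rewrite (big_cat_nat (leq0n i.+1) iN)/= big_nat_cond big_pred0 ?add0r; last first.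
  by move=> j; apply/negbTE/negP => /andP[]; rewrite ltnS /= leqNgt => /negP.
rewrite [leLHS](_ : _ = \sum_(i.+1 <= j < N) f j); last first.
  rewrite big_nat_cond [RHS]big_nat_cond; apply: eq_bigl => j.
  by case: (ltnP i j) => //=; rewrite ?andbT ?andbF.
rewrite -(add1n i) big_addn.
rewrite [leRHS](@big_cat_nat _ _ _ (maxn 1 (N - i))) ?leq_maxl//=; last first.
  by rewrite geq_max (leq_ltn_trans (leq0n i) iN) leq_subr.
have -> : \sum_(1 <= m < N - i) f (m + i)%N = \sum_(1 <= m < maxn 1 (N - i)) f (i + m)%N.
  by rewrite (maxn_idPr _) ?subn_gt0//; apply: eq_bigr => m _; rewrite addnC.
by rewrite lerDl sumr_ge0.
Qed.

Lemma sum_sym_ord (N : nat) (F : nat -> nat -> R) :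
  (forall i j, F i j = F j i) -> (forall i, F i i = 0) ->
  \sum_(i < N) \sum_(j < N) F i j =
  2 * \sum_(i < N) \sum_(j < N | (i < j)%N) F i j.
Proof.
move=> Fsym F0.
have split_row (i : 'I_N) : \sum_(j < N) F i j =
    \sum_(j < N | (i < j)%N) F i j + \sum_(j < N | (j < i)%N) F i j.
  rewrite (bigID (fun j : 'I_N => (i < j)%N))/=; congr (_ + _).
  rewrite (bigID (fun j : 'I_N => (j < i)%N))/= [X in _ + X]big1 ?addr0.
    by apply: eq_bigl => j; case: ltngtP.
  by move=> j; rewrite -!leqNgt => /andP[h1 h2]; rewrite (_ : nat_of_ord j = i) ?F0//; apply/eqP; rewrite eqn_leq h1.
under eq_bigr do rewrite split_row.
rewrite big_split/= mulr2n mulrDl mul1r; congr (_ + _).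
rewrite (exchange_big_dep xpredT)//=.
by apply: eq_bigr => i _; apply: eq_bigr => j _; rewrite Fsym.
Qed.

(** The weight of a pair of mesh cells: at most the true weight at every pair
    of points of the two cells, and zero for equal cells. *)
Definition cell_weight (N i j : nat) : R :=
  if i == j then 0 else (((i - j) + (j - i)).+1%:R / N%:R) `^ a.

(** The path is sampled at the right end of each cell, the side on which a cadlag
    path is continuous. *)
Definition riemann_silt (n : nat) (g x : R -> R) : R :=
  (n.+1%:R)^-1 * \sum_(i < n.+1) ((n.+1%:R)^-1 * \sum_(j < n.+1)
    cell_weight n.+1 i j * g (x (i.+1%:R / n.+1%:R) - x (j.+1%:R / n.+1%:R))).

Lemma cell_weight_ge0 N i j : 0 <= cell_weight N i j.
Proof. by rewrite /cell_weight; case: ifP => // _; rewrite powR_ge0. Qed.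

Lemma cell_weightC N i j : cell_weight N i j = cell_weight N j i.
Proof. by rewrite /cell_weight eq_sym addnC. Qed.

Lemma sum_cell_weight_le n i : -1 < a -> (i <= n.+1)%N ->
  (n.+1%:R)^-1 * \sum_(j < n.+1) cell_weight n.+1 i j <= 2 / (a + 1).
Proof.
move=> a1 iN; set N := n.+1; have N0 : 0 < N%:R :> R by rewrite ltr0n.
have d0 : 0 < a + 1 by lra.
have d1 : a + 1 <= 1 by rewrite gerDr.
pose h (m : nat) : R := (m.+1%:R / N%:R) `^ a.
have h0 m : 0 <= h m by exact: powR_ge0.
have hle m : (m.+2%:R / N%:R) `^ a <= h m.
  by apply: powR_nincr => //; [rewrite divr_gt0|rewrite ler_wpM2r ?invr_ge0 ?(ltW N0)// ler_nat].
have H k : (k <= N)%N -> (N%:R)^-1 * \sum_(m < k) h m <= (a + 1)^-1.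
  move=> kN; apply: le_trans (sum_powR_le N d0 d1).
  rewrite -mulr_sumr ler_wpM2l ?invr_ge0 ?(ltW N0)// addrK.
  exact: (ler_sum_ord (F := h)).
have -> : 2 / (a + 1) = (a + 1)^-1 + (a + 1)^-1 by rewrite mulr2n mulrDl mul1r.
rewrite -(big_mkord xpredT (cell_weight N i)) (big_cat_nat (leq0n i) iN)/=.
rewrite mulrDr lerD//.
  apply: le_trans (H i iN).
  rewrite ler_wpM2l ?invr_ge0 ?(ltW N0)// big_nat_rev/= add0n big_mkord.
  apply: ler_sum => m _; rewrite /cell_weight.
  have mi := ltn_ord m.
  case: ifPn => // _; rewrite subKn// (_ : (i - m.+1 - i)%N = 0%N) ?addn0//.
  by apply/eqP; rewrite subn_eq0 leq_subr.
move: iN; rewrite leq_eqVlt => /predU1P[->|iN].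
  by rewrite big_geq// mulr0 invr_ge0 ltW.
rewrite big_ltn// {1}/cell_weight eqxx add0r.
apply: le_trans (H (N - i.+1)%N (leq_subr _ _)).
rewrite ler_wpM2l ?invr_ge0 ?(ltW N0)// -(add0n i.+1) big_addn big_mkord.
apply: ler_sum => m _; rewrite /cell_weight; case: ifPn => // _.
rewrite -addSnnS addnK (_ : (i - (m.+1 + i))%N = 0%N) ?add0n//.
by apply/eqP; rewrite subn_eq0 leq_addl.
Qed.

Lemma riemann_silt_ge0 n g x : (forall y, 0 <= g y) -> 0 <= riemann_silt n g x.
Proof.
move=> g0; rewrite mulr_ge0 ?invr_ge0// sumr_ge0// => i _.
rewrite mulr_ge0 ?invr_ge0// sumr_ge0// => j _.
by rewrite mulr_ge0// cell_weight_ge0.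
Qed.

Lemma riemann_silt_le n g x C : -1 < a -> (forall y, 0 <= g y) -> (forall y, g y <= C) ->
  riemann_silt n g x <= C * (2 / (a + 1)).
Proof.
move=> a1 g0 gC; have N0 : 0 < n.+1%:R :> R by rewrite ltr0n.
have C0 : 0 <= C by exact: le_trans (gC 0).
rewrite /riemann_silt.
apply: (@le_trans _ _ ((n.+1%:R)^-1 * \sum_(i < n.+1) C * (2 / (a + 1)))); last first.
  by rewrite average_const.
rewrite ler_wpM2l ?invr_ge0 ?(ltW N0)//; apply: ler_sum => i _.
apply: (@le_trans _ _ (C * ((n.+1%:R)^-1 * \sum_(j < n.+1) cell_weight n.+1 i j))).
  rewrite mulrCA ler_wpM2l ?invr_ge0 ?(ltW N0)// mulr_sumr; apply: ler_sum => j _.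
  by rewrite mulrC ler_wpM2r// cell_weight_ge0.
by rewrite ler_wpM2l// sum_cell_weight_le// ltnW.
Qed.

(** Jensen's inequality, from the tangent line of the exponential at the average. *)
Lemma expR_average_le n (y : nat -> R) :
  expR ((n.+1%:R)^-1 * \sum_(i < n.+1) y i) <=
  (n.+1%:R)^-1 * \sum_(i < n.+1) expR (y i).
Proof.
have N0 : 0 < n.+1%:R :> R by rewrite ltr0n.
set m := _ * \sum_(i < _) y i.
have h (i : 'I_n.+1) : expR m * (1 + (y i - m)) <= expR (y i).
  have -> : expR (y i) = expR m * expR (y i - m) by rewrite -expRD addrC subrK.
  by rewrite ler_wpM2l ?expR_ge0// expR_ge1Dx.
rewrite ler_pdivlMl//.
apply: le_trans (ler_sum _ (fun i _ => h i)).
rewrite -mulr_sumr big_split/= sumrB !sumr_const card_ord.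
rewrite -[m *+ _]mulr_natl {3}/m mulrA mulfV ?gt_eqF// mul1r subrr addr0.
by rewrite mulrC.
Qed.

(** By symmetry the pairs of cells in increasing order suffice, with doubled
    weights; the later cell is then reached from the earlier one by going forward. *)
Lemma riemann_silt_le_forward n (g x : R -> R) :
  (forall y, 0 <= g y) -> (forall y, g (- y) = g y) ->
  riemann_silt n g x <= (n.+1%:R)^-1 * \sum_(i < n.+1) \sum_(1 <= m < n.+1)
    2 / n.+1%:R * (m.+1%:R / n.+1%:R) `^ a *
    g (x ((i + m).+1%:R / n.+1%:R) - x (i.+1%:R / n.+1%:R)).
Proof.
move=> g0 gN; set N := n.+1; have N0 : 0 < N%:R :> R by rewrite ltr0n.
pose t i : R := i.+1%:R / N%:R.
pose F i j := cell_weight N i j * g (x (t i) - x (t j)).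
rewrite /riemann_silt ler_wpM2l ?invr_ge0 ?(ltW N0)// -mulr_sumr.
rewrite (sum_sym_ord N (F := F)); last 2 first.
- by move=> i j; rewrite /F cell_weightC -[in RHS]gN opprB.
- by move=> i; rewrite /F /cell_weight eqxx mul0r.
rewrite mulrA mulr_sumr; apply: ler_sum => i _.
have F0 j : 0 <= F i j by rewrite mulr_ge0// cell_weight_ge0.
apply: le_trans (ler_wpM2l _ (sum_gt_ord_le (ltn_ord i) F0)) _.
  by rewrite mulr_ge0 ?invr_ge0 ?(ltW N0).
rewrite mulr_sumr !big_add1 /= !big_mkord; apply: ler_sum => m _.
rewrite /F /cell_weight (_ : (nat_of_ord i == (i + m.+1)%N) = false); last first.
  by apply/negbTE; rewrite neq_ltn addnS ltnS leq_addr.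
rewrite -[x in _ <= _ * g x]opprB gN (mulrC (N%:R^-1)) mulrA.
by rewrite addKn (_ : (i - (i + m.+1))%N = 0%N) ?add0n//; apply/eqP; rewrite subn_eq0 leq_addr.
Qed.

End riemann_silt.

(** * Moments of the Riemann sums *)

Section silt_moments.
Context d (T : measurableType d) (R : realType) (P : probability T R).
Variables (X : R -> {RV P >-> R}) (rho c a : R).
Hypotheses (rho1 : 1 <= rho) (c0 : 0 < c) (a0 : a <= 0).
Hypothesis a_rho : 0 < a - rho^-1 + 1.
Hypothesis stableX : symmetric_stable_levy_process rho c X.

Let rho0 : 0 < rho. Proof. exact: lt_le_trans rho1. Qed.

Let a1 : -1 < a.
Proof. have : 0 < rho^-1 by rewrite invr_gt0. move: a_rho; lra. Qed.

Definition silt_sum (eps : R) n w := riemann_silt a n (heat_kernel eps) (X ^~ w).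

Lemma heat_kernelN (eps x : R) : heat_kernel eps (- x) = heat_kernel eps x.
Proof. by rewrite /heat_kernel sqrrN. Qed.

Lemma silt_sum_ge0 eps n w : 0 <= silt_sum eps n w.
Proof. by apply: riemann_silt_ge0 => y; exact: heat_kernel_ge0. Qed.

Lemma silt_sum_le eps n w : 0 < eps ->
  silt_sum eps n w <= heat_peak eps * (2 / (a + 1)).
Proof.
move=> e0; apply: riemann_silt_le => // y; first exact: heat_kernel_ge0.
exact: heat_kernel_le.
Qed.

Lemma bounded_mfun_silt_sum eps n : 0 < eps -> bounded_mfun (silt_sum eps n).
Proof.
move=> e0; apply: bounded_mfunZ; apply: bounded_mfun_sum => i.
apply: bounded_mfunZ; apply: bounded_mfun_sum => j; apply: bounded_mfunZ.
by apply: bounded_mfun_heat_kernel => //; exact: measurable_funB.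
Qed.

(** The mass that the weight gives to a single cell has order [N `^ (- (a + 1))]. *)
Lemma near_small_cell (b eps : R) : 0 < eps -> 0 <= b ->
  \forall n \near \oo, b / n.+1%:R * (n.+1%:R)^-1 `^ a * heat_peak eps <= 2^-1.
Proof.
move=> e0 b0; have d0 : 0 < a + 1 by move: a1; lra.
pose C := 2 * b * heat_peak eps.
have pk0 : 0 <= heat_peak eps by rewrite invr_ge0 sqrtr_ge0.
have C0 : 0 <= C by rewrite !mulr_ge0.
near=> n; set N := n.+1; have N0 : 0 < N%:R :> R by rewrite ltr0n.
have NC : C `^ (a + 1)^-1 <= N%:R.
  apply: (@le_trans _ _ n%:R); last by rewrite ler_nat.
  by near: n; exact: nbhs_infty_ger.
have CN : C <= N%:R `^ (a + 1).
  have -> : C = (C `^ (a + 1)^-1) `^ (a + 1) by rewrite -powRrM mulVf ?gt_eqF// powRr1.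
  by apply: ge0_ler_powR; rewrite ?nnegrE ?powR_ge0// ltW.
have -> : b / N%:R * N%:R^-1 `^ a * heat_peak eps = (C / N%:R `^ (a + 1)) / 2.
  have -> : N%:R^-1 `^ a = (N%:R `^ a)^-1 by rewrite -powR_inv1 ?(ltW N0)// -powRrM mulN1r powRN.
  rewrite powRD; last by apply/implyP => _; rewrite gt_eqF.
  rewrite powRr1 ?(ltW N0)// /C; field.
  by rewrite (gt_eqF N0) gt_eqF// powR_gt0.
rewrite ler_pdivrMr// mulVf ?gt_eqF// ler_pdivrMr ?powR_gt0// mul1r//.
Unshelve. all: end_near. Qed.

(** Uniform exponential moments: Jensen's inequality over the starting cell
    leaves the additive functional of a single start. *)
Lemma expectation_exp_silt_sum_le (beta : R) : 0 <= beta ->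
  exists K : R, forall eps, 0 < eps ->
    \forall n \near \oo, \int[P]_w expR (beta * silt_sum eps n w) <= K.
Proof.
move=> b0; have b20 : 0 <= 2 * beta by rewrite mulr_ge0.
have [K K0 HK] := expectation_exp_sum_le rho1 c0 a0 a_rho stableX b20.
exists K => eps e0; near=> n.
have pk : 2 * beta / n.+1%:R * (n.+1%:R)^-1 `^ a * heat_peak eps <= 2^-1.
  by near: n; exact: near_small_cell.
have {}HK j := HK eps n j e0 pk.
set N := n.+1 in HK *; have N0 : 0 < N%:R :> R by rewrite ltr0n.
pose y j w := \sum_(1 <= i < N) 2 * beta / N%:R * (i.+1%:R / N%:R) `^ a *
  heat_kernel eps (X ((j + i).+1%:R / N%:R) w - X (j.+1%:R / N%:R) w).
have by_ j : bounded_mfun (y j).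
  apply: bounded_mfun_sum => i; apply: bounded_mfunZ.
  by apply: bounded_mfun_heat_kernel => //; exact: measurable_funB.
have bey j : bounded_mfun (fun w => expR (y j w)) by exact: bounded_mfun_expR.
apply: (@le_trans _ _ (\int[P]_w (N%:R^-1 * \sum_(j < N) expR (y j w)))).
  apply: le_expectation.
  - by apply: bounded_mfun_expR; apply: bounded_mfunZ; exact: bounded_mfun_silt_sum.
  - by apply: bounded_mfunZ; exact: bounded_mfun_sum.
  move=> w; apply: le_trans (expR_average_le n (fun j => y j w)).
  rewrite ler_expR.
  apply: le_trans (ler_wpM2l b0 (riemann_silt_le_forward a n (X ^~ w)
    (@heat_kernel_ge0 R eps) (heat_kernelN eps))) _.
  rewrite mulrCA ler_wpM2l ?invr_ge0 ?(ltW N0)// mulr_sumr.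
  apply: ler_sum => i _; rewrite mulr_sumr; apply: ler_sum => m _.
  by apply: eq_ler; ring.
rewrite expectation_mulr; last exact: bounded_mfun_sum.
rewrite expectation_sumr//.
apply: (@le_trans _ _ (N%:R^-1 * \sum_(j < N) K)).
  by rewrite ler_wpM2l ?invr_ge0 ?(ltW N0)//; apply: ler_sum => j _; exact: HK.
by rewrite average_const.
Unshelve. all: end_near. Qed.

(** Term by term, because the weights of the double sums are nonnegative. *)
Lemma expectation_silt_sum2_nincr e1 e2 e1' e2' n :
  0 < e1 -> e1 <= e2 -> 0 < e1' -> e1' <= e2' ->
  \int[P]_w (silt_sum e2 n w * silt_sum e2' n w) <=
  \int[P]_w (silt_sum e1 n w * silt_sum e1' n w).
Proof.
move=> e10 e12 e10' e12'; set N := n.+1.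
have N0 : 0 < N%:R :> R by rewrite ltr0n.
have e20 : 0 < e2 by exact: lt_le_trans e12.
have e20' : 0 < e2' by exact: lt_le_trans e12'.
pose t i : R := i.+1%:R / N%:R.
have t0 i : 0 <= t i by rewrite divr_ge0// ltW.
pose h e (p : 'I_N * 'I_N) w := heat_kernel e (X (t p.1) w - X (t p.2) w).
pose k (p : 'I_N * 'I_N) : R := (N%:R)^-1 * ((N%:R)^-1 * cell_weight a N p.1 p.2).
have k0 p : 0 <= k p by rewrite !mulr_ge0 ?invr_ge0 ?(ltW N0)// cell_weight_ge0.
have bh e p : 0 < e -> bounded_mfun (h e p).
  by move=> e0; apply: bounded_mfun_heat_kernel => //; exact: measurable_funB.
have SE e w : silt_sum e n w = \sum_p k p * h e p w.
  rewrite /silt_sum /riemann_silt mulr_sumr.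
  under eq_bigr do rewrite mulrA mulr_sumr.
  rewrite pair_bigA/=; apply: eq_bigr => p _.
  by rewrite /k /h !mulrA.
have prodE e e' : 0 < e -> 0 < e' -> \int[P]_w (silt_sum e n w * silt_sum e' n w) =
    \sum_p \sum_p' k p * k p' * \int[P]_w (h e p w * h e' p' w).
  move=> e0 e0'.
  under eq_Rintegral do rewrite !SE big_distrlr/=.
  rewrite expectation_sumr; last first.
    by move=> p; apply: bounded_mfun_sum => p'; apply: bounded_mfunM; apply: bounded_mfunZ; exact: bh.
  apply: eq_bigr => p _; rewrite expectation_sumr; last first.
    by move=> p'; apply: bounded_mfunM; apply: bounded_mfunZ; exact: bh.
  apply: eq_bigr => p' _; rewrite -expectation_mulr; last by apply: bounded_mfunM; exact: bh.
  by apply: eq_Rintegral => w _; rewrite mulrACA.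
rewrite !prodE//; apply: ler_sum => p _; apply: ler_sum => p' _.
apply: (ler_wpM2l (mulr_ge0 (k0 p) (k0 p'))).
by apply: (expectation_heat_kernel2_nincr stableX).
Qed.

End silt_moments.

(** * Pathwise convergence of the Riemann sums *)

Section step_functions.
Context {R : realType}.
Notation mu := (@lebesgue_measure R).
Notation truncn := Num.truncn.
Local Notation I01 := (`[(0 : R), (1 : R)]%classic).

Lemma measurable_step n (f : nat -> R) :
  measurable_fun I01 (fun s : R => f (truncn (s * n.+1%:R))).
Proof.
have N0 : 0 < n.+1%:R :> R by rewrite ltr0n.
apply: (eq_measurable_fun (fun s : R => \sum_(i < n.+2)
    f i * \1_(`[i%:R / n.+1%:R, i.+1%:R / n.+1%:R[%classic : set R) s)); last first.
  by apply: measurable_sum => i _; apply: measurable_funM => //; exact: measurable_indic.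
move=> s; rewrite inE/= in_itv/= => /andP[s0 s1].
have sN0 : 0 <= s * n.+1%:R by rewrite mulr_ge0// ltW.
have tn : (truncn (s * n.+1%:R) < n.+2)%N.
  by rewrite ltnS truncn_le_nat; apply: (@le_lt_trans _ _ n.+1%:R); rewrite ?ltr_nat// ler_piMl// ltW.
rewrite (bigD1 (Ordinal tn))//= big1 ?addr0.
  rewrite indicE mem_set ?mulr1//= in_itv/= ler_pdivrMr// ltr_pdivlMr//.
  exact: truncn_itv.
move=> i iNt; rewrite indicE memNset ?mulr0//= in_itv/= ler_pdivrMr// ltr_pdivlMr//.
by move/truncn_def => iE; move/eqP: iNt; apply; apply/val_inj; rewrite /= -iE.
Qed.

Lemma integral_step n (f : nat -> R) : (forall i, 0 <= f i) ->
  (\int[mu]_(s in `[0%R, 1%R]) (f (truncn (s * n.+1%:R)))%:E =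
   ((n.+1%:R)^-1 * \sum_(i < n.+1) f i)%:E)%E.
Proof.
move=> f0; have N0 : 0 < n.+1%:R :> R by rewrite ltr0n.
have mf01 : measurable_fun I01 (fun s : R => (f (truncn (s * n.+1%:R)))%:E).
  by apply/measurable_EFinP; exact: measurable_step.
rewrite -integral_itv_bndo_bndc; last first.
  by apply: measurable_funS mf01 => //; exact: subset_itv_co_cc.
suff H k : (k <= n.+1)%N -> (\int[mu]_(s in `[0%R, (k%:R / n.+1%:R)%R[)
    (f (truncn (s * n.+1%:R)))%:E = ((n.+1%:R)^-1 * \sum_(i < k) f i)%:E)%E.
  by have := H n.+1 (leqnn _); rewrite divff// gt_eqF.
elim: k => [_|k IH kn].
  by rewrite mul0r set_itvco0 integral_set0 big_ord0 mulr0.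
have k1 : (k%:R / n.+1%:R <= k.+1%:R / n.+1%:R :> R).
  by rewrite ler_wpM2r ?invr_ge0 ?(ltW N0)// ler_nat.
have k0 : 0 <= k%:R / n.+1%:R :> R by rewrite divr_ge0// ltW.
have kn1 : k.+1%:R / n.+1%:R <= 1 :> R by rewrite ler_pdivrMr// mul1r ler_nat.
have unE : `[0, k.+1%:R / n.+1%:R[%classic =
    `[0, k%:R / n.+1%:R[ `|` `[k%:R / n.+1%:R, k.+1%:R / n.+1%:R[ :> set R.
  by rewrite -itv_bndbnd_setU// bnd_simp.
rewrite unE ge0_integral_setU//=.
- rewrite IH ?(ltnW kn)// big_ord_recr/= mulrDr EFinD; congr (_ + _)%E.
  rewrite (eq_integral (cst (f k)%:E)); last first.
    move=> s; rewrite inE/= in_itv/= ler_pdivrMr// ltr_pdivlMr// => ks.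
    by rewrite (truncn_def ks).
  rewrite integral_cst//= lebesgue_measure_itv/= lte_fin ltr_pM2r ?invr_gt0// ltr_nat ltnSn.
  by rewrite -EFinD -EFinM -mulrBl -natr1 addrAC subrr add0r mul1r mulrC.
- rewrite -unE; apply: measurable_funS mf01 => //.
  by apply: subset_itv; rewrite bnd_simp.
- by move=> s _; rewrite lee_fin.
- apply/disj_setPS => s [] /=; rewrite !in_itv/= => /andP[_ h1] /andP[h2 _].
  by have := lt_le_trans h1 h2; rewrite ltxx.
Qed.

Lemma cvg_natV : (n.+1%:R)^-1 @[n --> \oo] --> (0 : R).
Proof. exact: cvg_harmonic. Qed.

Lemma truncn_cvg (r : R) : 0 <= r ->
  (truncn (r * n.+1%:R))%:R / n.+1%:R @[n --> \oo] --> r.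
Proof.
move=> r0; apply/cvgrPdist_le => e e0; near=> n.
have N0 : 0 < n.+1%:R :> R by rewrite ltr0n.
have /andP[h1 h2] : (truncn (r * n.+1%:R))%:R <= r * n.+1%:R < (truncn (r * n.+1%:R)).+1%:R.
  by rewrite truncn_itv// mulr_ge0// ltW.
have Ne : (n.+1%:R)^-1 <= e.
  near: n; have /cvgrPdist_le/(_ _ e0) := cvg_natV.
  apply: filterS => n; rewrite sub0r normrN ger0_norm// invr_ge0//.
apply: le_trans Ne.
rewrite ger0_norm ?subr_ge0 ?ler_pdivrMr//.
by rewrite -(ler_pM2r N0) mulrBl divfK ?gt_eqF// mulVf ?gt_eqF// lerBlDr addrC natr1 ltW.
Unshelve. all: end_near. Qed.

(** The right end of the mesh cell of [r] approaches [r] strictly from the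
    right, which is the side on which cadlag paths are continuous. *)
Lemma right_cell_cvg (x : R -> R) (r : R) : 0 <= r ->
  x s @[s --> r^'+] --> x r ->
  x ((truncn (r * n.+1%:R)).+1%:R / n.+1%:R) @[n --> \oo] --> x r.
Proof.
move=> r0 xr.
have h : (truncn (r * n.+1%:R)).+1%:R / n.+1%:R @[n --> \oo] --> r^'+.
  have h1 : (truncn (r * n.+1%:R)).+1%:R / n.+1%:R @[n --> \oo] --> r.
    have -> : (fun n => (truncn (r * n.+1%:R)).+1%:R / n.+1%:R) =
       (fun n => (truncn (r * n.+1%:R))%:R / n.+1%:R + (n.+1%:R)^-1) :> (nat -> R).
      by apply/funext => n; rewrite -natr1 mulrDl mul1r.
    by rewrite -[X in _ --> X]addr0; apply: cvgD; [exact: truncn_cvg|exact: cvg_natV].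
  move=> A; rewrite /at_right /within/= => rA.
  have [m _ hm] := h1 _ rA; exists m => // n mn; apply: (hm n mn).
  have N0 : 0 < n.+1%:R :> R by rewrite ltr0n.
  by rewrite ltr_pdivlMr// truncnS_gt.
exact: cvg_comp h xr.
Qed.

End step_functions.

Section pathwise.
Context {R : realType}.
Notation mu := (@lebesgue_measure R).
Notation truncn := Num.truncn.
Local Notation I01 := (`[(0 : R), (1 : R)]%classic).
Variables (a C : R) (x g : R -> R).
Hypotheses (a0 : a <= 0) (a1 : -1 < a).
Hypothesis xr : forall t, 0 <= t -> x s @[s --> t^'+] --> x t.
Hypotheses (cg : continuous g) (g0 : forall y, 0 <= g y) (gC : forall y, g y <= C).

Let C0 : 0 <= C. Proof. exact: le_trans (gC 0). Qed.

Let kernel n (i j : nat) : R := cell_weight a n.+1 i j *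
  g (x (i.+1%:R / n.+1%:R) - x (j.+1%:R / n.+1%:R)).

Let wt n (r s : R) := cell_weight a n.+1 (truncn (r * n.+1%:R)) (truncn (s * n.+1%:R)).

(** The weights of the cells stay below the true weight, which thus dominates the
    Riemann sums. *)
Let wt_le n (r s : R) : 0 <= r -> 0 <= s -> wt n r s <= `|r - s| `^ a.
Proof.
wlog rs : r s / (truncn (s * n.+1%:R) <= truncn (r * n.+1%:R))%N.
  move=> H r0 s0; have /orP[h|h] := leq_total (truncn (s * n.+1%:R)) (truncn (r * n.+1%:R)).
    exact: H.
  by rewrite /wt cell_weightC distrC; exact: H.
move=> r0 s0; rewrite /wt /cell_weight; case: ifPn => [_|ij]; first exact: powR_ge0.
have N0 : 0 < n.+1%:R :> R by rewrite ltr0n.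
have /andP[r1 r2] : (truncn (r * n.+1%:R))%:R <= r * n.+1%:R < (truncn (r * n.+1%:R)).+1%:R.
  by rewrite truncn_itv// mulr_ge0// ltW.
have /andP[s1 s2] : (truncn (s * n.+1%:R))%:R <= s * n.+1%:R < (truncn (s * n.+1%:R)).+1%:R.
  by rewrite truncn_itv// mulr_ge0// ltW.
move: (truncn (r * _)) (truncn (s * _)) rs ij r1 r2 s1 s2 => i j ij inj r1 r2 s1 s2.
have ltij : (j < i)%N by rewrite ltn_neqAle eq_sym inj.
have sr : s < r.
  rewrite -(ltr_pM2r N0); apply: lt_le_trans s2 _; apply: le_trans r1.
  by rewrite ler_nat.
have ji0 : (j - i = 0)%N by apply/eqP; rewrite subn_eq0.
rewrite ji0 addn0 gtr0_norm ?subr_gt0//; apply: powR_nincr => //.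
  by rewrite subr_gt0.
rewrite ler_pdivlMr// mulrBl -[(i - j).+1%:R]natr1 natrB ?(ltnW ltij)//.
by move: r2; rewrite -natr1; lra.
Qed.

Let wt_cvg (r s : R) : 0 <= r -> 0 <= s -> s != r ->
  wt n r s @[n --> \oo] --> `|r - s| `^ a.
Proof.
wlog rs : r s / s < r.
  move=> H r0 s0 sr; have [h|h|h] := ltgtP s r; last by rewrite h eqxx in sr.
    exact: H.
  rewrite distrC (_ : (fun n => wt n r s) = (fun n => wt n s r)).
    by apply: H => //; rewrite eq_sym.
  by apply/funext => n; rewrite /wt cell_weightC.
move=> r0 s0 _; rewrite gtr0_norm ?subr_gt0//.
pose u n : R := (truncn (r * n.+1%:R))%:R / n.+1%:R - (truncn (s * n.+1%:R))%:R / n.+1%:R + (n.+1%:R)^-1.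
have uc : u n @[n --> \oo] --> r - s.
  rewrite -[X in _ --> X]addr0; apply: cvgD; last exact: cvg_natV.
  by apply: cvgB; exact: truncn_cvg.
have rs0 : 0 < r - s by rewrite subr_gt0.
have cp : {for r - s, continuous (fun z : R => z `^ a)}.
  apply/differentiable_continuous/derivable1_diffP.
  by have [] := @is_derive1_powR R a (r - s) rs0.
have pc : (u n) `^ a @[n --> \oo] --> (r - s) `^ a by exact: (continuous_cvg _ cp uc).
apply: cvg_trans pc; apply: near_eq_cvg; near=> n.
have N0 : 0 < n.+1%:R :> R by rewrite ltr0n.
have Ne : (n.+1%:R)^-1 < r - s.
  near: n; have e0 : 0 < r - s by rewrite subr_gt0.
  have /cvgrPdist_lt/(_ _ e0) := @cvg_natV R.
  apply: filterS => n; rewrite sub0r normrN ger0_norm// invr_ge0//.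
rewrite /wt /cell_weight /u.
have /andP[r1 r2] : (truncn (r * n.+1%:R))%:R <= r * n.+1%:R < (truncn (r * n.+1%:R)).+1%:R.
  by rewrite truncn_itv// mulr_ge0// ltW.
have /andP[s1 s2] : (truncn (s * n.+1%:R))%:R <= s * n.+1%:R < (truncn (s * n.+1%:R)).+1%:R.
  by rewrite truncn_itv// mulr_ge0// ltW.
move: (truncn (r * _)) (truncn (s * _)) r1 r2 s1 s2 => i j r1 r2 s1 s2.
have ltij : (j < i)%N.
  have : j%:R < i%:R :> R.
    have : 1 < (r - s) * n.+1%:R by rewrite -ltr_pdivrMr// mul1r.
    by move: r2; rewrite mulrBl -natr1; lra.
  by rewrite ltr_nat.
rewrite gtn_eqF// (_ : (j - i = 0)%N) ?addn0; last by apply/eqP; rewrite subn_eq0 ltnW.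
congr (_ `^ _); rewrite -[(i - j).+1%:R]natr1 natrB ?(ltnW ltij)//.
by rewrite mulrDl mulrBl mul1r.
Unshelve. all: end_near. Qed.

Let measurable_path : measurable_fun I01 x.
Proof.
apply/measurable_EFinP.
apply: (emeasurable_fun_cvg (fun n (s : R) => (x ((truncn (s * n.+1%:R)).+1%:R / n.+1%:R))%:E)).
  move=> n; apply/measurable_EFinP.
  exact: (measurable_step n (fun k => x (k.+1%:R / n.+1%:R))).
move=> s /=; rewrite in_itv/= => /andP[s0 s1].
apply/cvg_EFin; first by near=> n.
exact: (right_cell_cvg s0 (xr s0)).
Unshelve. all: end_near. Qed.

Let D1 (r : R) : set R := `[0, 1] `\ r.

Let mD1 r : measurable (D1 r : set (measurableTypeR R)). Proof. exact: measurableD. Qed.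

Let D1P r s : D1 r s -> [/\ 0 <= s, s <= 1 & s != r].
Proof. by move=> [/= + /eqP]; rewrite in_itv/= => /andP[]. Qed.

Let measurable_weight r : measurable_fun setT (fun s : R => `|r - s| `^ a).
Proof.
apply: (measurableT_comp (measurable_powR a)); apply: measurableT_comp => //.
exact: measurable_funB.
Qed.

Let measurable_wt n r : measurable_fun I01 (wt n r).
Proof. exact: (measurable_step n (cell_weight a n.+1 (truncn (r * n.+1%:R)))). Qed.

Let sub01 r : D1 r `<=` I01. Proof. by move=> s []. Qed.

Let cell_bound n (r : R) : 0 <= r -> r <= 1 -> (truncn (r * n.+1%:R) <= n.+1)%N.
Proof.
move=> r0 r1; rewrite truncn_le_nat; apply: (@le_lt_trans _ _ n.+1%:R).
  by rewrite ler_piMl.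
by rewrite ltr_nat.
Qed.

(** The singular weight is integrable, by Fatou's lemma from the uniform bound
    on its Riemann sums. *)
Let integral_weight_le r : 0 <= r -> r <= 1 ->
  (\int[mu]_(s in D1 r) (`|r - s| `^ a)%:E <= (2 / (a + 1))%:E)%E.
Proof.
move=> r0 r1.
have lim s : D1 r s -> (`|r - s| `^ a)%:E = limn_einf (fun n => (wt n r s)%:E).
  move=> /D1P[s0 s1 sr]; apply/esym.
  have h : (wt n r s)%:E @[n --> \oo] --> (`|r - s| `^ a)%:E.
    by apply/cvg_EFin; [near=> n|exact: wt_cvg].
  rewrite is_cvg_limn_einfE; first exact: cvg_lim h.
  by apply/cvg_ex; exists (`|r - s| `^ a)%:E.
under eq_integral => s; first by rewrite inE => /lim ->; over.
have mw n : measurable_fun (D1 r) (fun s => (wt n r s)%:E).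
  apply/measurable_EFinP; apply: measurable_funS (measurable_wt n r) => //.
apply: le_trans (fatou mu (mD1 r) mw _) _.
  by move=> n s _; rewrite lee_fin cell_weight_ge0.
have le n : (\int[mu]_(s in D1 r) (wt n r s)%:E <= (2 / (a + 1))%:E)%E.
  have -> : (\int[mu]_(s in D1 r) (wt n r s)%:E = ((n.+1%:R)^-1 *
      \sum_(i < n.+1) cell_weight a n.+1 (truncn (r * n.+1%:R)) i)%:E)%E.
    rewrite (@integral_setD1 _ _ r I01 (mD1 r))//.
    apply: (integral_step n (f := cell_weight a n.+1 (truncn (r * n.+1%:R)))) => i.
    exact: cell_weight_ge0.
  by rewrite lee_fin; apply: sum_cell_weight_le => //; exact: cell_bound.
rewrite limn_einf_lim; apply: lime_le; first exact: is_cvg_einfs.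
by apply: nearW => n; apply: le_trans (le n); apply: ereal_inf_lbound; exists n => /=.
Unshelve. all: end_near. Qed.

Let integrable_weight r : 0 <= r -> r <= 1 ->
  mu.-integrable (D1 r) (EFin \o (fun s => `|r - s| `^ a)).
Proof.
move=> r0 r1; apply/integrableP; split.
  by apply/measurable_EFinP; exact: (measurable_funS measurableT (@subsetT _ _) (measurable_weight r)).
under eq_integral do rewrite /= ger0_norm ?powR_ge0//.
by apply: le_lt_trans (integral_weight_le r0 r1) _; rewrite ltry.
Qed.

Let integrable_Cweight r : 0 <= r -> r <= 1 ->
  mu.-integrable (D1 r) (EFin \o (fun s => C * `|r - s| `^ a)).
Proof.
move=> r0 r1.
rewrite (_ : _ \o _ = (fun s : R => C%:E * (`|r - s| `^ a)%:E)%E); last first.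
  by apply/funext => s; rewrite /= EFinM.
by apply: integrableZl => //; exact: integrable_weight.
Qed.

Let row n (r : R) : R :=
  (n.+1%:R)^-1 * \sum_(j < n.+1) kernel n (truncn (r * n.+1%:R)) j.

Let limit_row (r : R) : R := \int[mu]_(s in D1 r) (`|r - s| `^ a * g (x r - x s)).

Let row_ge0 n r : 0 <= row n r.
Proof.
by rewrite mulr_ge0 ?invr_ge0// sumr_ge0// => j _; rewrite mulr_ge0// cell_weight_ge0.
Qed.

Let row_le n r : 0 <= r -> r <= 1 -> row n r <= C * (2 / (a + 1)).
Proof.
move=> r0 r1.
apply: le_trans (ler_wpM2l C0 (sum_cell_weight_le a0 a1 (cell_bound n r0 r1))).
rewrite mulrCA ler_wpM2l ?invr_ge0// mulr_sumr; apply: ler_sum => j _.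
by rewrite /kernel mulrC ler_wpM2r// cell_weight_ge0.
Qed.

Let measurable_limit_kernel r :
  measurable_fun (D1 r) (fun s => `|r - s| `^ a * g (x r - x s)).
Proof.
apply: measurable_funM; first exact: (measurable_funS measurableT (@subsetT _ _) (measurable_weight r)).
apply: (measurableT_comp (continuous_measurable_fun cg)).
by apply: measurable_funB => //; apply: measurable_funS measurable_path => //.
Qed.

Let row_cvg r : 0 <= r -> r <= 1 -> row n r @[n --> \oo] --> limit_row r.
Proof.
move=> r0 r1.
pose f_ n (s : R) : R := kernel n (truncn (r * n.+1%:R)) (truncn (s * n.+1%:R)).
have mf_ n : measurable_fun (D1 r) (f_ n).
  apply: measurable_funS (measurable_step n (kernel n (truncn (r * n.+1%:R)))) => //.
have rowE n : row n r = \int[mu]_(s in D1 r) f_ n s.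
  rewrite /Rintegral (@integral_setD1 _ _ r I01 (mD1 r)); last exact/measurable_EFinP.
  rewrite (integral_step n (f := kernel n (truncn (r * n.+1%:R))))//.
  by move=> i; rewrite mulr_ge0// cell_weight_ge0.
rewrite (_ : (fun n => row n r) = (fun n => \int[mu]_(s in D1 r) f_ n s)); last first.
  exact/funext.
have cf s : D1 r s -> f_ n s @[n --> \oo] --> `|r - s| `^ a * g (x r - x s).
  move=> /D1P[s0 s1 sr]; apply: cvgM; first exact: wt_cvg.
  have e1 : x ((truncn (r * n.+1%:R)).+1%:R / n.+1%:R) -
      x ((truncn (s * n.+1%:R)).+1%:R / n.+1%:R) @[n --> \oo] --> x r - x s.
    by apply: cvgB; apply: right_cell_cvg => //; exact: xr.
  have e2 := @cg (x r - x s).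
  exact: (cvg_comp _ _ e1 e2).
have ig := integrable_Cweight r0 r1.
have fg s n : D1 r s -> `|f_ n s| <= C * `|r - s| `^ a.
  move=> /D1P[s0 s1 sr].
  rewrite ger0_norm ?mulr_ge0 ?cell_weight_ge0// mulrC.
  by apply: ler_pM => //; [exact: cell_weight_ge0|exact: wt_le].
exact: (dominated_cvg_EFin (mD1 r) mf_ cf ig fg).
Qed.

Let limit_rowE r : 0 <= r -> r <= 1 ->
  (\int[mu]_(s in I01) (`|r - s| `^ a * g (x r - x s))%:E)%E = (limit_row r)%:E.
Proof.
move=> r0 r1.
have mk : measurable_fun (D1 r) (fun s => (`|r - s| `^ a * g (x r - x s))%:E).
  by apply/measurable_EFinP; exact: measurable_limit_kernel.
have iI : mu.-integrable (D1 r) (EFin \o (fun s => `|r - s| `^ a * g (x r - x s))).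
  apply: (@le_integrable _ _ _ mu _ (mD1 r) _ (EFin \o (fun s => C * `|r - s| `^ a))).
  - exact: mk.
  - move=> s _; rewrite /= lee_fin ger0_norm ?mulr_ge0 ?powR_ge0//.
    rewrite [leRHS]ger0_norm ?mulr_ge0 ?powR_ge0//.
    by rewrite mulrC ler_wpM2r// powR_ge0.
  - exact: integrable_Cweight.
rewrite -(@integral_setD1 _ _ r I01 (mD1 r) mk) /limit_row /Rintegral fineK//.
exact: (integrable_fin_num (mD1 r) iI).
Qed.

(** Dominated convergence in the second time for each value of the first one, then
    in the first time, where the rows are uniformly bounded. *)
Lemma riemann_silt_cvg : exists2 I : R,
  (\int[mu]_(r in I01) \int[mu]_(s in I01) (`|r - s| `^ a * g (x r - x s))%:E)%E = I%:E &
  riemann_silt a n g x @[n --> \oo] --> I.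
Proof.
have mrow n : measurable_fun I01 (row n).
  exact: (measurable_step n (fun i => (n.+1%:R)^-1 * \sum_(j < n.+1) kernel n i j)).
have crow r : I01 r -> row n r @[n --> \oo] --> limit_row r.
  by rewrite /= in_itv/= => /andP[r0 r1]; exact: row_cvg.
have iC : mu.-integrable I01 (EFin \o cst (C * (2 / (a + 1)))).
  apply/integrableP; split; first exact/measurable_EFinP.
  rewrite /= integral_cst//= lebesgue_measure_itv/= lte_fin ltr01 oppr0 adde0 mule1.
  by rewrite ltry.
have rC r n : I01 r -> `|row n r| <= cst (C * (2 / (a + 1))) r.
  by rewrite /= in_itv/= => /andP[r0 r1]; rewrite ger0_norm// row_le.
exists (\int[mu]_(r in I01) limit_row r).
  transitivity (\int[mu]_(r in I01) (limit_row r)%:E)%E.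
    by apply: eq_integral => r; rewrite inE/= in_itv/= => /andP[r0 r1]; exact: limit_rowE.
  rewrite /Rintegral fineK//; apply: integrable_fin_num => //.
  have mlim : measurable_fun I01 limit_row.
    apply/measurable_EFinP.
    apply: (emeasurable_fun_cvg (fun n => EFin \o row n)) => [n|r Ir].
      exact/measurable_EFinP.
    by apply/cvg_EFin; [near=> n|exact: crow].
  apply: (@le_integrable _ _ _ mu _ _ _ (EFin \o cst (C * (2 / (a + 1))))) => //.
    exact/measurable_EFinP.
  move=> r Ir; rewrite /= lee_fin.
  have lim_le : `|limit_row r| <= C * (2 / (a + 1)).
    have h : `|row n r| @[n --> \oo] --> `|limit_row r| by apply: cvg_norm; exact: crow.
    rewrite -(cvg_lim _ h)//; apply: limr_le; first by apply/cvg_ex; exists `|limit_row r|.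
    by near=> n; exact: rC.
  by rewrite (le_trans lim_le)// ler_norm.
rewrite (_ : (fun n => riemann_silt a n g x) = (fun n => \int[mu]_(r in I01) row n r)).
  exact: (dominated_cvg_EFin (g := cst (C * (2 / (a + 1))))).
apply/funext => n; rewrite /Rintegral.
rewrite (integral_step n (f := fun i => (n.+1%:R)^-1 * \sum_(j < n.+1) kernel n i j))//.
move=> i; rewrite mulr_ge0 ?invr_ge0// sumr_ge0// => j _.
by rewrite mulr_ge0// cell_weight_ge0.
Unshelve. all: end_near. Qed.

End pathwise.

(** * Null sets, limits and quadratic norms *)

Section fatou.
Context d (T : measurableType d) (R : realType).
Variable mu : {measure set T -> \bar R}.

Lemma fatou_cvg (f_ : nat -> T -> R) (f : T -> R) (u : nat -> R) (l : R) :
  (forall n, measurable_fun setT (f_ n)) -> measurable_fun setT f ->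
  (forall n x, 0 <= f_ n x) -> (forall x, 0 <= f x) ->
  {ae mu, forall x, f_ n x @[n --> \oo] --> f x} ->
  (forall n, \int[mu]_x (f_ n x)%:E <= (u n)%:E)%E -> u n @[n --> \oo] --> l ->
  (\int[mu]_x (f x)%:E <= l%:E)%E.
Proof.
move=> mf_ mf f_0 f0 [N [mN N0 cN]] fu ul.
have mE n D : measurable_fun D (fun x => (f_ n x)%:E).
  by apply/measurable_EFinP; exact: measurable_funTS.
have mfE : measurable_fun setT (fun x => (f x)%:E) by exact/measurable_EFinP.
have mND : measurable (setT `\` N) by exact: measurableD.
rewrite (ge0_negligible_integral mN measurableT mfE _ N0); last by move=> x _; rewrite lee_fin.
rewrite (@eq_integral _ _ _ mu _ (fun x => limn_einf (fun n => (f_ n x)%:E))); last first.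
  move=> x; rewrite inE => -[_ Nx].
  have fx : f_ n x @[n --> \oo] --> f x by apply: contrapT => h; apply: Nx; exact: cN.
  have h : (f_ n x)%:E @[n --> \oo] --> (f x)%:E by apply/cvg_EFin; [near=> n|].
  by rewrite is_cvg_limn_einfE; [exact/esym/cvg_lim|apply/cvg_ex; exists (f x)%:E].
apply: le_trans (fatou mu mND (fun n => mE n _) _) _.
  by move=> n x _; rewrite lee_fin.
have le n : (\int[mu]_(x in setT `\` N) (f_ n x)%:E <= (u n)%:E)%E.
  apply: le_trans (fu n); apply: ge0_subset_integral => // x _.
  by rewrite lee_fin.
have uE : (u n)%:E @[n --> \oo] --> l%:E by apply/cvg_EFin; [near=> n|].
rewrite limn_einf_lim -(cvg_lim _ uE)//; apply: lee_lim.
- exact: is_cvg_einfs.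
- by apply/cvg_ex; exists l%:E.
- by near=> n; apply: le_trans (le n); apply: ereal_inf_lbound; exists n => /=.
Unshelve. all: end_near. Qed.

Import HBNNSimple.

Let ge0_integral_ae_le (f g : T -> \bar R) :
  (forall x, 0 <= f x)%E -> (forall x, 0 <= g x)%E -> {ae mu, forall x, f x = g x} ->
  (\int[mu]_x f x <= \int[mu]_x g x)%E.
Proof.
move=> f0 g0 [N [mN N0 cN]].
rewrite [leLHS]ge0_integralTE// [leRHS]ge0_integralTE//.
apply: ge_ereal_sup => _ [h hf <-].
apply: ereal_sup_ubound; exists (proj_nnsfun h (measurableC mN)) => /=.
  move=> x; rewrite /= mindicE; have [xN|xN] := pselect (N x).
    by rewrite memNset ?mulr0//; exact: g0.
  rewrite mem_set// mulr1 -(_ : f x = g x); first exact: hf.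
  by apply: contrapT => h'; apply: xN; exact: cN.
rewrite -2!integralT_nnsfun; apply/esym.
apply: ge0_ae_eq_integral => //.
- exact/measurable_EFinP.
- exact/measurable_EFinP.
- by move=> x _; rewrite lee_fin.
- by move=> x _; rewrite lee_fin.
exists N; split=> // x /= /not_implyP[_ h'].
apply: contrapT => xN; apply: h'; rewrite /= mindicE mem_set ?mulr1//.
Qed.

(** The regularized functional is only known to coincide with a measurable
    function off a null set, and the underlying measure space need not be complete. *)
Lemma ge0_integral_ae_eq (f g : T -> \bar R) :
  (forall x, 0 <= f x)%E -> (forall x, 0 <= g x)%E -> {ae mu, forall x, f x = g x} ->
  (\int[mu]_x f x = \int[mu]_x g x)%E.
Proof.
move=> f0 g0 fg; apply/eqP; rewrite eq_le !ge0_integral_ae_le//.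
by apply: filterS fg => x ->.
Qed.

Lemma Lnorm2_sqr (f : T -> \bar R) (Z : T -> R) :
  {ae mu, forall x, f x = (Z x)%:E} ->
  ('N[mu]_2%:E[f] `^ 2 = \int[mu]_x (Z x ^+ 2)%:E)%E.
Proof.
move=> fZ; rewrite poweR_Lnorm//; apply: ge0_integral_ae_eq.
- by move=> x; exact: poweR_ge0.
- by move=> x; rewrite lee_fin sqr_ge0.
- apply: filterS fZ => x ->; rewrite /= powR_mulrn//.
  by rewrite -normrX ger0_norm// sqr_ge0.
Qed.

Lemma Lnorm2_le (f : T -> \bar R) (Z : T -> R) (v : R) : 
  {ae mu, forall x, f x = (Z x)%:E} ->
  (\int[mu]_x (Z x ^+ 2)%:E <= v%:E)%E -> ('N[mu]_2%:E[f] <= (Num.sqrt v)%:E)%E.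
Proof.
move=> /Lnorm2_sqr <-.
have := Lnorm_ge0 mu 2%:E f; case: ('N[mu]_2%:E[f])%E => [r| |]//=; last first.
  by rewrite pnatr_eq0.
  rewrite !lee_fin => r0; rewrite powR_mulrn// => rv.
  by rewrite -(ger0_norm r0) -sqrtr_sqr ler_wsqrtr.
Qed.

Lemma Lnorm2_cvg0 (I : Type) (F : set_system I) {FF : Filter F} 
    (f : I -> T -> \bar R) (Z : I -> T -> R) (v : I -> R) :
  (\forall i \near F, {ae mu, forall x, f i x = (Z i x)%:E}) ->
  (\forall i \near F, \int[mu]_x (Z i x ^+ 2)%:E <= (v i)%:E)%E ->
  v i @[i --> F] --> 0 -> ('N[mu]_2%:E[f i] @[i --> F] --> 0)%E.
Proof.
move=> fZ Zv v0.
have sv : (Num.sqrt (v i))%:E @[i --> F] --> (0 : R)%:E.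
  apply/cvg_EFin; first by near=> i.
  rewrite -(@sqrtr0 R); apply: continuous_cvg => //; exact: sqrt_continuous.
apply: (squeeze_cvge _ (cvg_cst 0%E) sv).
near=> i; rewrite Lnorm_ge0/=; apply: (@Lnorm2_le _ (Z i)).
  by near: i.
by near: i.
Unshelve. all: end_near. Qed.

Lemma cvg_ge0_sqr_lt (I : Type) (F : set_system I) {FF : Filter F}
    (f : I -> T -> \bar R) (Z : I -> T -> R) (v : R) :
  (\forall i \near F, {ae mu, forall x, f i x = (Z i x)%:E}) ->
  ('N[mu]_2%:E[f i] @[i --> F] --> 0)%E -> 0 < v ->
  \forall i \near F, (\int[mu]_x (Z i x ^+ 2)%:E <= v%:E)%E.
Proof.
move=> fZ N0 v0.
have s0 : 0 < Num.sqrt v by rewrite sqrtr_gt0.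
have /fine_cvgP[Nfin /cvgrPdist_lt/(_ _ s0)] := N0.
move=> Nlt; near=> i.
have fZi : {ae mu, forall x, f i x = (Z i x)%:E} by near: i.
rewrite -(Lnorm2_sqr fZi).
have : `|0 - fine ('N[mu]_2%:E[f i])%E| < Num.sqrt v by near: i.
have : ('N[mu]_2%:E[f i])%E \is a fin_num by near: i.
have := Lnorm_ge0 mu 2%:E (f i); case: ('N[mu]_2%:E[f i])%E => [r| |]//=.
rewrite !lee_fin => r0 _; rewrite sub0r normrN ger0_norm// => rv.
rewrite powR_mulrn// -[leRHS]sqr_sqrtr ?(ltW v0)//.
by rewrite ler_pXn2r ?nnegrE ?sqrtr_ge0// ltW.
Unshelve. all: end_near. Qed.

End fatou.
Section limsup.
Context {R : realType}.

Lemma limn_esup_bounded (u : nat -> R) (M : R) : (forall n, 0 <= u n <= M) ->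
  0 <= fine (limn_esup (fun n => (u n)%:E)) <= M.
Proof.
move=> uM.
have h1 : (0 <= limn_esup (fun n => (u n)%:E))%E.
  rewrite limn_esup_lim; apply: lime_ge; first exact: is_cvg_esups.
  apply: nearW => n; apply: (@le_trans _ _ (u n)%:E).
    by rewrite lee_fin; case/andP: (uM n).
  by apply: ereal_sup_ubound; exists n => /=.
have h2 : (limn_esup (fun n => (u n)%:E) <= M%:E)%E.
  rewrite limn_esup_lim; apply: lime_le; first exact: is_cvg_esups.
  apply: nearW => n; apply: ge_ereal_sup => _ [k _ <-].
  by rewrite lee_fin; case/andP: (uM k).
rewrite -!lee_fin fineK; first by rewrite h1 h2.
by rewrite ge0_fin_numE// (le_lt_trans h2)// ltry.
Qed.

Lemma fine_limn_esup_cvg (u : nat -> R) (l : R) : u n @[n --> \oo] --> l ->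
  fine (limn_esup (fun n => (u n)%:E)) = l.
Proof.
move=> ul.
have ul' : (u k)%:E @[k --> \oo] --> l%:E by apply/cvg_EFin; [near=> k|].
rewrite is_cvg_limn_esupE; last by apply/cvg_ex; exists l%:E.
by rewrite (cvg_lim _ ul').
Unshelve. all: end_near. Qed.

End limsup.

(** * Limits of families with monotone mixed moments *)

Section l2_limit.
Context d (T : measurableType d) (R : realType) (P : probability T R).

Lemma summable_increments_cvg (Y : nat -> R) :
  (\sum_(0 <= n <oo) `|Y n.+1 - Y n|%:E \is a fin_num)%E ->
  cvg (Y n @[n --> \oo]).
Proof.
move=> fin.
have YE : Y = (fun n => Y 0%N + series (telescope Y) n).
  by apply/funext => n; rewrite -eq_sum_telescope.
rewrite YE; apply: is_cvgD; first exact: is_cvg_cst.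
apply: normed_cvg.
have nd : nondecreasing_seq [normed series (telescope Y)].
  by apply: nondecreasing_series => n _ _ /=.
apply: (nondecreasing_is_cvgn nd).
exists (fine (\sum_(0 <= n <oo) `|Y n.+1 - Y n|%:E)%E) => _ [n _ <-].
rewrite -lee_fin fineK//.
apply: le_trans (nneseries_lim_ge n _); last by move=> k _ _; rewrite lee_fin.
by rewrite /= sumEFin.
Qed.

Variable I : R -> T -> R.
Hypothesis bI : forall e, 0 < e -> bounded_mfun (I e).
Hypothesis I2_nincr : forall e1 e2 e1' e2', 0 < e1 -> e1 <= e2 -> 0 < e1' -> e1' <= e2' ->
  \int[P]_w (I e2 w * I e2' w) <= \int[P]_w (I e1 w * I e1' w).
Variable K : R.
Let v e := \int[P]_w (I e w * I e w).
Hypothesis vK : forall e, 0 < e -> v e <= K.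

Let dist_le1 e1 e2 : 0 < e1 -> e1 <= e2 ->
  \int[P]_w (I e1 w - I e2 w) ^+ 2 <= v e1 - v e2.
Proof.
move=> e10 e12; have e20 : 0 < e2 by exact: lt_le_trans e12.
have b11 := bounded_mfunM (bI e10) (bI e10).
have b12 := bounded_mfunM (bI e10) (bI e20).
have b22 := bounded_mfunM (bI e20) (bI e20).
rewrite (_ : \int[P]_w (I e1 w - I e2 w) ^+ 2 =
    \int[P]_w (I e1 w * I e1 w + (I e2 w * I e2 w - 2 * (I e1 w * I e2 w)))); last first.
  by apply: eq_Rintegral => w _; ring.
rewrite expectation_addr ?expectation_subr ?expectation_mulr//; last 2 first.
  exact: bounded_mfunZ.
  by apply: bounded_mfunB => //; exact: bounded_mfunZ.
have := I2_nincr e10 e12 e20 (lexx e2).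
by rewrite /v; lra.
Qed.

Let dist_le e1 e2 : 0 < e1 -> 0 < e2 ->
  \int[P]_w (I e1 w - I e2 w) ^+ 2 <= `|v e1 - v e2|.
Proof.
move=> e10 e20; have /orP[e12|e21] := le_total e1 e2.
  by apply: le_trans (dist_le1 e10 e12) _; exact: ler_norm.
rewrite distrC.
rewrite (_ : \int[P]_w (I e1 w - I e2 w) ^+ 2 = \int[P]_w (I e2 w - I e1 w) ^+ 2); last first.
  by apply: eq_Rintegral => w _; ring.
by apply: le_trans (dist_le1 e20 e21) _; exact: ler_norm.
Qed.

Let v0 : R := sup [set v e | e in [set e | 0 < e]].

Let vsup : has_sup [set v e | e in [set e | 0 < e]].
Proof.
split; first by exists (v 1), 1 => //=.
by exists K => _ [e /= e0 <-]; exact: vK.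
Qed.

Let v_le e : 0 < e -> v e <= v0.
Proof. by move=> e0; apply: sup_upper_bound => //; exists e. Qed.

Let dist_intE e1 e2 : 0 < e1 -> 0 < e2 ->
  (\int[P]_w ((I e1 w - I e2 w) ^+ 2)%:E = (\int[P]_w (I e1 w - I e2 w) ^+ 2)%:E)%E.
Proof.
move=> e10 e20; apply: EFin_Rintegral.
rewrite (_ : (fun _ => _) = (fun w => (I e1 w - I e2 w) * (I e1 w - I e2 w))); last first.
  by apply/funext => w; rewrite expr2.
by apply: bounded_mfunM; apply: bounded_mfunB; exact: bI.
Qed.

(** As the scale shrinks the second moments increase to a finite limit, and
    monotonicity of the mixed moments turns their increments into bounds on the
    squared distances: the family is Cauchy.  A subsequence with summable
    increments converges almost surely, and Fatou's lemma gives the bound on the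
    distance from its limit. *)
Lemma monotone_l2_limit : exists L : T -> R, measurable_fun setT L /\
  exists u : R -> R, u e @[e --> (0 : R)^'+] --> 0 /\
    forall e, 0 < e -> (\int[P]_w ((I e w - L w) ^+ 2)%:E <= (u e)%:E)%E.
Proof.
(* Widths whose second moments are within [4 ^- k] of their supremum. *)
have /choice[e_ eP] : forall k : nat, exists e, 0 < e /\ v0 - (2^-1) ^+ k * (2^-1) ^+ k < v e.
  move=> k; have t0 : 0 < (2^-1 : R) ^+ k * (2^-1) ^+ k by rewrite mulr_gt0 ?exprn_gt0.
  by have [_ [e /= e0 <-] ve] := sup_adherent t0 vsup; exists e.
have e0 k : 0 < e_ k by case: (eP k).
pose Y k w := I (e_ k) w.
have bY k : bounded_mfun (Y k) by exact: bI.
have vcvg : v (e_ k) @[k --> \oo] --> v0.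
  have c0 : v0 - (2^-1) ^+ k * (2^-1) ^+ k @[k --> \oo] --> v0.
    rewrite -[X in _ --> X]subr0; apply: cvgB; first exact: cvg_cst.
    rewrite -(mul0r 0); apply: cvgM; apply: cvg_expr; rewrite ger0_norm//; lra.
  apply: (squeeze_cvgr _ c0 (cvg_cst v0)); near=> k.
  by have [_ /ltW ->] := eP k; rewrite v_le.
have incr k : (\int[P]_w `|Y k.+1 w - Y k w|%:E <= ((2^-1) ^+ k)%:E)%E.
  have bd : bounded_mfun (fun w => Y k.+1 w - Y k w) by exact: bounded_mfunB.
  have bn : bounded_mfun (fun w => `|Y k.+1 w - Y k w|).
    case: bd => md [M dM]; split; first exact: measurableT_comp.
    by exists M => w; rewrite normr_id.
  have bs : bounded_mfun (fun w => (Y k.+1 w - Y k w) ^+ 2).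
    rewrite (_ : (fun _ => _) = (fun w => (Y k.+1 w - Y k w) * (Y k.+1 w - Y k w))); last first.
      by apply/funext => w; rewrite expr2.
    exact: bounded_mfunM.
  rewrite EFin_Rintegral// lee_fin.
  pose q : R := 2^-1 ^+ k.
  have q0 : 0 < q by rewrite exprn_gt0.
  (* Any [q > 0] would do here; [2 ^- k] balances the square against [4 ^- k]. *)
  have le1 w : `|Y k.+1 w - Y k w| <= 2^-1 * q^-1 * (Y k.+1 w - Y k w) ^+ 2 + 2^-1 * q.
    rewrite -[(Y k.+1 w - Y k w) ^+ 2]real_normK ?num_real//.
    set x := `| _ |.
    have : 0 <= (x - q) ^+ 2 * q^-1 by rewrite mulr_ge0 ?sqr_ge0// invr_ge0 ltW.
    rewrite (_ : (x - q) ^+ 2 * q^-1 = q^-1 * x ^+ 2 - 2 * x + q); last by field; rewrite gt_eqF.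
    lra.
  apply: le_trans (le_expectation P bn _ le1) _.
    by apply: bounded_mfunD; [exact: bounded_mfunZ|exact: bounded_mfun_cst].
  rewrite (expectation_addr P (bounded_mfunZ _ bs) (bounded_mfun_cst _ _)).
  rewrite (expectation_mulr P _ bs) expectation_const.
  have : \int[P]_w (Y k.+1 w - Y k w) ^+ 2 <= q * q.
    apply: le_trans (dist_le (e0 k.+1) (e0 k)) _.
    have [_ h1] := eP k; have [_ h2] := eP k.+1.
    have h3 := v_le (e0 k); have h4 := v_le (e0 k.+1).
    have h5 : (2^-1) ^+ k.+1 * (2^-1) ^+ k.+1 <= q * q.
      by rewrite exprS -/q; nra.
    rewrite ler_norml; apply/andP; split; rewrite -/q in h1; lra.
  move=> h; rewrite -/q.
  have : q^-1 * \int[P]_w (Y k.+1 w - Y k w) ^+ 2 <= q.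
    by rewrite mulrC ler_pdivrMr.
  by rewrite -mulrA; lra.
have mY k : measurable_fun setT (Y k) by case: (bY k).
have mincr k : measurable_fun setT (fun w => `|Y k.+1 w - Y k w|%:E).
  by apply/measurable_EFinP; apply: measurableT_comp => //; exact: measurable_funB.
have ae1 : {ae P, forall w, cvg (Y k w @[k --> \oo])}.
  have int : P.-integrable setT (fun w => \sum_(0 <= k <oo) `|Y k.+1 w - Y k w|%:E)%E.
    apply/integrableP; split.
      apply: ge0_emeasurable_sum => // k w _ _; rewrite lee_fin//.
    rewrite (@eq_integral _ _ _ P _ (fun w => \sum_(0 <= k <oo) `|Y k.+1 w - Y k w|%:E)%E); last first.
      by move=> w _; rewrite gee0_abs// nneseries_ge0// => k _ _; rewrite lee_fin.
    rewrite integral_nneseries//.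
    apply: (@le_lt_trans _ _ (\sum_(0 <= k <oo) ((2^-1 : R) ^+ k)%:E)%E).
      by apply: lee_nneseries => k _; rewrite ?integral_ge0// => w _; rewrite lee_fin.
    have := @cvg_geometric_eseries_half R 2 0; rewrite expr0 divr1.
    rewrite (_ : (fun k => _) = (fun k => ((2^-1 : R) ^+ k)%:E)); last first.
      apply/funext => k; rewrite addn1 natrX exprS invfM mulrA divff ?mul1r ?exprVn//.
    by move=> /cvg_lim h; rewrite (_ : limn _ = 2%:E) ?ltry// -h.
  have := integrable_ae measurableT int.
  by apply: filterS => w /(_ Logic.I); exact: summable_increments_cvg.
pose L w := fine (limn_esup (fun k => (Y k w)%:E)).
have mL : measurable_fun setT L.
  apply: measurableT_comp => //; apply: measurable_fun_limn_esup => k.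
  exact/measurable_EFinP.
have aeL : {ae P, forall w, Y k w @[k --> \oo] --> L w}.
  apply: filterS ae1 => w /cvg_ex[l Yl].
  by rewrite /L (fine_limn_esup_cvg Yl).
exists L; split=> //; exists (fun e => v0 - v e); split.
  apply/cvgrPdist_lt => dl dl0.
  have [_ [e1 /= e10 <-] ve1] := sup_adherent dl0 vsup.
  near=> e; have e0' : 0 < e by near: e; exact: nbhs_right_gt.
  have ee1 : e <= e1 by near: e; exact: nbhs_right_le.
  have := I2_nincr e0' ee1 e0' ee1; rewrite -/(v _) -/(v _) => vv.
  rewrite sub0r normrN ger0_norm ?subr_ge0 ?v_le//.
  by rewrite -/v0 in ve1; lra.
move=> e e0'.
apply: (@fatou_cvg _ _ _ P (fun k w => (I e w - Y k w) ^+ 2) _ (fun k => `|v e - v (e_ k)|)).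
- move=> k; apply: measurable_funX; apply: measurable_funB => //; by case: (bI e0').
- by apply: measurable_funX; apply: measurable_funB => //; case: (bI e0').
- by move=> k w; exact: sqr_ge0.
- by move=> w; exact: sqr_ge0.
- apply: filterS aeL => w Yw; rewrite expr2.
  under eq_fun do rewrite expr2.
  by apply: cvgM; apply: cvgB => //; exact: cvg_cst.
- by move=> k; rewrite dist_intE// lee_fin; exact: dist_le.
- rewrite -[v0 - _]ger0_norm ?subr_ge0 ?v_le// distrC.
  by apply: cvg_norm; apply: cvgB => //; exact: cvg_cst.
Unshelve. all: end_near. Qed.

End l2_limit.

(** * Exponential moments of a limit in quadratic mean *)

Section exponential_moment.
Context d (T : measurableType d) (R : realType) (P : probability T R).

(** The convexity inequality [expR y >= expR x * (1 + (y - x))] transfers the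
    bound to the truncation of [L] at any level, with an error controlled by the
    distance in the mean; the truncation is then removed by Fatou's lemma. *)
Lemma expectation_exp_l2_limit (L : T -> R) (beta K : R) :
  0 <= beta -> measurable_fun setT L ->
  (forall v, 0 < v -> exists Y : T -> R, [/\ bounded_mfun Y,
     \int[P]_w expR (beta * Y w) <= K &
     (\int[P]_w ((Y w - L w) ^+ 2)%:E <= v%:E)%E]) ->
  (\int[P]_w (expR (beta * L w))%:E <= K%:E)%E.
Proof.
move=> b0 mL HY.
pose A (n : nat) : set T := L @^-1` `]-oo, n%:R].
have mA n : measurable (A n) by rewrite -[A n]setTI; exact: mL.
have mE : measurable_fun setT (fun w => expR (beta * L w)).
  by apply: measurableT_comp => //; exact: measurable_funM.
have mZ n : measurable_fun setT (fun w => \1_(A n) w * expR (beta * L w)).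
  by apply: measurable_funM => //; exact: measurable_indic.
apply: (@fatou_cvg _ _ _ P (fun n w => \1_(A n) w * expR (beta * L w)) _ (fun=> K)) => //.
- apply: aeW => w; rewrite -[X in _ --> X]mul1r.
  apply: cvg_near_cst; near=> n.
  have wA : A n w by rewrite /A/= in_itv/= ltW//; near: n; exact: nbhs_infty_gtr.
  by rewrite indicE mem_set.
- move=> n.
  pose C := beta * expR (beta * n%:R).
  have C0 : 0 <= C by rewrite mulr_ge0 ?expR_ge0.
  apply/lee_addgt0Pr => eta eta0.
  (* The error at distance at most [q] in quadratic mean is [C * q <= eta]. *)
  pose q := eta / (C + 1).
  have q0 : 0 < q by rewrite divr_gt0// ltr_wpDl.
  have [Y [bY YK YL]] := HY (q ^+ 2) (exprn_gt0 _ q0).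
  have bE : bounded_mfun (fun w => expR (beta * Y w)).
    by apply: bounded_mfun_expR; exact: bounded_mfunZ.
  have mY : measurable_fun setT Y by case: bY.
  have k0 : 0 <= C / (2 * q) by rewrite divr_ge0// mulr_ge0// ltW.
  have Cq0 : 0 <= C * q / 2 by rewrite divr_ge0// mulr_ge0// ltW.
  have ptw w : \1_(A n) w * expR (beta * L w) <=
      expR (beta * Y w) + (C / (2 * q) * (Y w - L w) ^+ 2 + C * q / 2).
    rewrite indicE; have [wA|wA] := pselect (A n w); last first.
      by rewrite memNset// mul0r addr_ge0 ?expR_ge0// addr_ge0// mulr_ge0 ?sqr_ge0.
    rewrite mem_set// mul1r.
    have Ln : L w <= n%:R by move: wA; rewrite /A/= in_itv.
    have h1 : expR (beta * L w) * (1 + beta * (Y w - L w)) <= expR (beta * Y w).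
      rewrite (_ : beta * Y w = beta * L w + beta * (Y w - L w)); last by ring.
      by rewrite expRD ler_wpM2l ?expR_ge0// expR_ge1Dx.
    have h2 : beta * expR (beta * L w) <= C.
      by rewrite ler_wpM2l// ler_expR ler_wpM2l.
    have h3 : `|Y w - L w| <= (Y w - L w) ^+ 2 / (2 * q) + q / 2.
      rewrite -[(Y w - L w) ^+ 2]real_normK ?num_real//; set x := `| _ |.
      have : 0 <= (x - q) ^+ 2 / (2 * q).
        by rewrite mulr_ge0 ?sqr_ge0// invr_ge0 mulr_ge0// ltW.
      rewrite (_ : (x - q) ^+ 2 / (2 * q) = x ^+ 2 / (2 * q) + q / 2 - x); first lra.
      by field; rewrite gt_eqF.
    have h4 : - (beta * expR (beta * L w) * (Y w - L w)) <= C * `|Y w - L w|.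
      rewrite -mulrN; apply: (@le_trans _ _ (beta * expR (beta * L w) * `|Y w - L w|)).
        by rewrite ler_wpM2l ?mulr_ge0 ?expR_ge0// -normrN ler_norm.
      by rewrite ler_wpM2r.
    have h5 := ler_wpM2l C0 h3.
    have -> : C / (2 * q) * (Y w - L w) ^+ 2 + C * q / 2 =
        C * ((Y w - L w) ^+ 2 / (2 * q) + q / 2) by ring.
    lra.
  have mS : measurable_fun setT (fun w => ((Y w - L w) ^+ 2)%:E).
    by apply/measurable_EFinP; apply: measurable_funX; exact: measurable_funB.
  apply: (@le_trans _ _ (\int[P]_w ((expR (beta * Y w))%:E +
      ((C / (2 * q))%:E * ((Y w - L w) ^+ 2)%:E + (C * q / 2)%:E)))%E).
    apply: ge0_le_integral => //.
    - exact/measurable_EFinP.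
    - apply: emeasurable_funD; first by apply/measurable_EFinP; case: bE.
      by apply: emeasurable_funD => //; apply: emeasurable_funM.
    - by move=> w _; rewrite -EFinM -!EFinD lee_fin.
  rewrite ge0_integralD//; last 3 first.
  - by apply/measurable_EFinP; case: bE.
  - by move=> w _; rewrite -EFinM -EFinD lee_fin addr_ge0// mulr_ge0// sqr_ge0.
  - by apply: emeasurable_funD => //; apply: emeasurable_funM.
  rewrite ge0_integralD//; last 2 first.
  - by move=> w _; rewrite -EFinM lee_fin mulr_ge0// sqr_ge0.
  - by apply: emeasurable_funM.
  rewrite ge0_integralZl//; last by move=> w _; rewrite lee_fin sqr_ge0.
  have -> : (\int[P]_w (C * q / 2)%:E = (C * q / 2)%:E)%E.
    by rewrite (EFin_Rintegral P (bounded_mfun_cst _ _)) expectation_const.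
  rewrite (EFin_Rintegral P bE).
  apply: leeD; first by rewrite lee_fin.
  apply: (@le_trans _ _ ((C / (2 * q))%:E * (q ^+ 2)%:E + (C * q / 2)%:E)%E).
    by apply: leeD => //; apply: lee_wpmul2l => //; rewrite lee_fin.
  rewrite -EFinM -EFinD lee_fin.
  have -> : C / (2 * q) * q ^+ 2 + C * q / 2 = C * q by field; rewrite gt_eqF.
  rewrite /q mulrA ler_pdivrMr ?ltr_wpDl// mulrDr mulr1 mulrC.
  by rewrite lerDl ltW.
- exact: cvg_cst.
Unshelve. all: end_near. Qed.

End exponential_moment.

(** * The self-intersection local time *)

Section stable_silt.
Context d (T : measurableType d) (R : realType) (P : probability T R).
Variables (X : R -> {RV P >-> R}) (rho c H : R).
Hypotheses (H1 : H <= 1) (rho1 : 1 <= rho) (c0 : 0 < c).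
Hypothesis H_rho : 0 < 2 * H - 2 - rho^-1 + 1.
Hypothesis stableX : symmetric_stable_levy_process rho c X.

Let a := 2 * H - 2.
Let a0 : a <= 0. Proof. move: H1; rewrite /a; lra. Qed.
Let a1 : -1 < a.
Proof.
have : 0 < rho^-1 by rewrite invr_gt0 (lt_le_trans ltr01).
by move: H_rho; rewrite -/a; lra.
Qed.

(** A version of the regularized functional that is measurable and bounded on the
    whole space, whereas the iterated integral is controlled along cadlag paths. *)
Definition silt_limsup (eps : R) (w : T) : R :=
  fine (limn_esup (fun n => (silt_sum X (2 * H - 2) eps n w)%:E)).

Lemma bounded_mfun_silt_limsup eps : 0 < eps -> bounded_mfun (silt_limsup eps).
Proof.
move=> e0; split.
  apply: measurableT_comp => //; apply: measurable_fun_limn_esup => n.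
  apply/measurable_EFinP; by case: (bounded_mfun_silt_sum X a n e0).
exists (heat_peak eps * (2 / (a + 1))) => w.
have /limn_esup_bounded/andP[h0 hM] : forall n,
    0 <= silt_sum X a eps n w <= heat_peak eps * (2 / (a + 1)).
  by move=> n; rewrite silt_sum_ge0 (silt_sum_le X rho1 a0 H_rho).
by rewrite ger0_norm.
Qed.

Lemma ae_cvg_silt_limsup : {ae P, forall w eps, 0 < eps ->
  regularized_silt X H eps w = (silt_limsup eps w)%:E /\
  silt_sum X a eps n w @[n --> \oo] --> silt_limsup eps w}.
Proof.
have [levyX _] := stableX.
apply: filterS (levy_cadlag levyX) => w [wr _] eps e0.
have [I IE Ic] := riemann_silt_cvg a0 a1 wr (@continuous_heat_kernel R eps)
  (heat_kernel_ge0 eps) (fun y => heat_kernel_le y e0).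
have -> : silt_limsup eps w = I by exact: fine_limn_esup_cvg.
by split=> //; rewrite -IE.
Qed.

Let silt_limsup2_cvg e e' : 0 < e -> 0 < e' ->
  \int[P]_w (silt_sum X a e n w * silt_sum X a e' n w) @[n --> \oo] -->
  \int[P]_w (silt_limsup e w * silt_limsup e' w).
Proof.
move=> e0 e0'.
pose C := heat_peak e * (2 / (a + 1)) * (heat_peak e' * (2 / (a + 1))).
have bs n := bounded_mfunM (bounded_mfun_silt_sum X a n e0) (bounded_mfun_silt_sum X a n e0').
have bl := bounded_mfunM (bounded_mfun_silt_limsup e0) (bounded_mfun_silt_limsup e0').
have H2 : {ae P, forall w, setT w ->
    silt_sum X a e n w * silt_sum X a e' n w @[n --> \oo] --> silt_limsup e w * silt_limsup e' w}.
  by apply: filterS ae_cvg_silt_limsup => w h _; apply: cvgM; apply h.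
have H3 : {ae P, forall w n, setT w ->
    `|silt_sum X a e n w * silt_sum X a e' n w| <= cst C w}.
  apply: aeW => w n _.
  have s0 := silt_sum_ge0 X a e n w; have s0' := silt_sum_ge0 X a e' n w.
  rewrite (ger0_norm (mulr_ge0 s0 s0')).
  exact: (ler_pM s0 s0' (silt_sum_le X rho1 a0 H_rho n w e0) (silt_sum_le X rho1 a0 H_rho n w e0')).
have [_] := dominated_cvg_ae measurableT (fun n => (bs n).1) bl.1 H2
  (bounded_mfun_integrable P (bounded_mfun_cst T C)) H3.
exact.
Qed.

Lemma expectation_silt_limsup2_nincr e1 e2 e1' e2' :
  0 < e1 -> e1 <= e2 -> 0 < e1' -> e1' <= e2' ->
  \int[P]_w (silt_limsup e2 w * silt_limsup e2' w) <=
  \int[P]_w (silt_limsup e1 w * silt_limsup e1' w).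
Proof.
move=> e10 e12 e10' e12'.
have e20 := lt_le_trans e10 e12; have e20' := lt_le_trans e10' e12'.
have c2 := silt_limsup2_cvg e20 e20'; have c1 := silt_limsup2_cvg e10 e10'.
apply: (ler_cvg_to c2 c1); apply: nearW => n.
exact: (expectation_silt_sum2_nincr a stableX).
Qed.

Lemma expectation_exp_silt_limsup_le beta : 0 <= beta ->
  exists K, forall e, 0 < e -> \int[P]_w expR (beta * silt_limsup e w) <= K.
Proof.
move=> b0.
have [K HK] := expectation_exp_silt_sum_le rho1 c0 a0 H_rho stableX b0.
exists K => e e0.
pose C := expR (beta * (heat_peak e * (2 / (a + 1)))).
have bs n : bounded_mfun (fun w => expR (beta * silt_sum X a e n w)).
  by apply: bounded_mfun_expR; apply: bounded_mfunZ; exact: bounded_mfun_silt_sum.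
have bl : bounded_mfun (fun w => expR (beta * silt_limsup e w)).
  by apply: bounded_mfun_expR; apply: bounded_mfunZ; exact: bounded_mfun_silt_limsup.
have H2 : {ae P, forall w, setT w ->
    expR (beta * silt_sum X a e n w) @[n --> \oo] --> expR (beta * silt_limsup e w)}.
  apply: filterS ae_cvg_silt_limsup => w h _.
  have hc : beta * silt_sum X a e n w @[n --> \oo] --> beta * silt_limsup e w.
    by apply: cvgM; [exact: cvg_cst|apply h].
  exact: (cvg_comp _ _ hc (@continuous_expR R _)).
have H3 : {ae P, forall w n, setT w -> `|expR (beta * silt_sum X a e n w)| <= cst C w}.
  apply: aeW => w n _; rewrite ger0_norm ?expR_ge0// ler_expR ler_wpM2l//.
  exact: (silt_sum_le X rho1 a0 H_rho).
have [_ cv] := dominated_cvg_ae measurableT (fun n => (bs n).1) bl.1 H2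
  (bounded_mfun_integrable P (bounded_mfun_cst T C)) H3.
apply: (cvgr_to_le cv); exact: HK.
Qed.

Let regularized_siltB (L : T -> R) : \forall eps \near (0 : R)^'+,
  {ae P, forall w, (regularized_silt X H eps \- (EFin \o L))%E w = (silt_limsup eps w - L w)%:E}.
Proof.
near=> eps; have e0 : 0 < eps by near: eps; exact: nbhs_right_gt.
apply: filterS ae_cvg_silt_limsup => w /(_ _ e0)[h _] /=.
by rewrite h EFinB.
Unshelve. all: end_near. Qed.

(** The second moments are dominated by exponential moments, hence bounded, and the
    mixed ones are monotone in the widths: the limit exists. *)
Lemma weighted_silt_exists : exists L : T -> R, weighted_silt X H L.
Proof.
have [K HK] := expectation_exp_silt_limsup_le (@ler01 R).
have vK e : 0 < e -> \int[P]_w (silt_limsup e w * silt_limsup e w) <= 4 * K.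
  move=> e0; apply: le_trans (ler_wpM2l _ (HK e e0)) => //.
  have bl := bounded_mfun_silt_limsup e0.
  have be : bounded_mfun (fun w => expR (1 * silt_limsup e w)).
    by apply: bounded_mfun_expR; apply: bounded_mfunZ.
  rewrite -expectation_mulr//; apply: le_expectation.
  - exact: bounded_mfunM.
  - exact: bounded_mfunZ.
  move=> w; rewrite mul1r.
  have s0 : 0 <= silt_limsup e w.
    have /limn_esup_bounded/andP[h0 hM] : forall n,
        0 <= silt_sum X a e n w <= heat_peak e * (2 / (a + 1)).
      by move=> n; rewrite silt_sum_ge0 (silt_sum_le X rho1 a0 H_rho).
    exact: h0.
  (* [x ^+ 2 <= 4 * expR x] for [x >= 0], as [expR (x / 2) >= 1 + x / 2]. *)
  have := expR_ge1Dx (silt_limsup e w / 2).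
  have -> : expR (silt_limsup e w) = expR (silt_limsup e w / 2) * expR (silt_limsup e w / 2).
    by rewrite -expRD; congr expR; field.
  set y := expR _ => hy; nra.
have [L [mL [u [u0 uL]]]] := monotone_l2_limit bounded_mfun_silt_limsup
  expectation_silt_limsup2_nincr vK.
exists L; split; last first.
  apply: (Lnorm2_cvg0 (regularized_siltB L) _ u0).
  near=> e; apply: uL; near: e; exact: nbhs_right_gt.
apply/andP; split; first exact: mem_set.
rewrite inE/= /finite_norm.
(* [L] is within a finite distance of the regularization of width 1. *)
have bl := bounded_mfun_silt_limsup (@ltr01 R).
have bs := bounded_mfunM bl bl.
have mI : measurable_fun setT (silt_limsup 1) by case: bl.
apply: (@le_lt_trans _ _ (Num.sqrt (2 * (4 * K) + 2 * u 1))%:E); last exact: ltry.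
apply: (@Lnorm2_le _ _ _ _ _ L); first by apply: aeW.
apply: (@le_trans _ _ (\int[P]_w (2%:E * (silt_limsup 1 w * silt_limsup 1 w)%:E +
    2%:E * ((silt_limsup 1 w - L w) ^+ 2)%:E))%E).
  apply: ge0_le_integral => //.
  - by move=> w _; rewrite lee_fin sqr_ge0.
  - by apply/measurable_EFinP; exact: measurable_funX.
  - apply/measurable_EFinP; apply: measurable_funD; apply: measurable_funM => //.
      by apply: measurable_funM.
    by apply: measurable_funX; exact: measurable_funB.
  - move=> w _; rewrite -!EFinM -EFinD lee_fin.
    have := sqr_ge0 (2 * silt_limsup 1 w - L w); nra.
have mS : measurable_fun setT (fun w => ((silt_limsup 1 w - L w) ^+ 2)%:E).
  by apply/measurable_EFinP; apply: measurable_funX; exact: measurable_funB.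
have mT : measurable_fun setT (fun w => (silt_limsup 1 w * silt_limsup 1 w)%:E).
  by apply/measurable_EFinP; exact: measurable_funM.
have s0 w : (0 <= ((silt_limsup 1 w - L w) ^+ 2)%:E)%E by rewrite lee_fin sqr_ge0.
have t0 w : (0 <= (silt_limsup 1 w * silt_limsup 1 w)%:E)%E.
  by rewrite lee_fin -expr2 sqr_ge0.
rewrite ge0_integralD//; last 4 first.
- by move=> w _; rewrite mule_ge0.
- exact: emeasurable_funM.
- by move=> w _; rewrite mule_ge0.
- exact: emeasurable_funM.
rewrite !ge0_integralZl// [leRHS]EFinD; apply: leeD.
  by rewrite (EFin_Rintegral P bs) -EFinM lee_fin ler_wpM2l// vK.
by rewrite [leRHS]EFinM; apply: lee_wpmul2l => //; exact: uL.
Unshelve. all: end_near. Qed.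

Lemma weighted_silt_exp_moment (L : T -> R) (beta : R) :
  weighted_silt X H L -> 0 < beta -> ('E_P[fun w => expR (beta * L w)] < +oo)%E.
Proof.
move=> [/andP[+ _] cL] b0; rewrite inE => mL.
have [K HK] := expectation_exp_silt_limsup_le (ltW b0).
apply: (@le_lt_trans _ _ K%:E); last exact: ltry.
rewrite expectation.unlock.
apply: expectation_exp_l2_limit => //; first exact: ltW.
move=> v v0.
have near1 : \forall e \near (0 : R)^'+,
    (\int[P]_w ((silt_limsup e w - L w) ^+ 2)%:E <= v%:E)%E.
  exact: (cvg_ge0_sqr_lt (regularized_siltB L) cL v0).
have [e [e0 eL]] : exists e, 0 < e /\ (\int[P]_w ((silt_limsup e w - L w) ^+ 2)%:E <= v%:E)%E.
  apply: (@filter_ex _ ((0 : R)^'+)).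
  by near=> e; split; [near: e; exact: nbhs_right_gt|near: e].
exists (silt_limsup e); split => //; first exact: bounded_mfun_silt_limsup.
exact: HK.
Unshelve. all: end_near. Qed.

End stable_silt.

Theorem proposition2p7 (d : measure_display) (T : measurableType d)
    (R : realType) (P : probability T R) (X : R -> {RV P >-> R})
    (H rho c : R) :
  1 / 2 < H -> H <= 1 ->
  1 < rho -> rho <= 2 ->
  1 / 2 < H - 1 / (2 * rho) ->
  0 < c ->
  symmetric_stable_levy_process rho c X ->
  (exists L : T -> R, weighted_silt X H L) /\
  (forall L : T -> R, weighted_silt X H L ->
     forall beta : R, 0 < beta ->
       ('E_P[fun w => expR (beta * L w)] < +oo)%E).
Proof.
move=> _ H1 rho1 _ theta c0 stableX.
have H_rho : 0 < 2 * H - 2 - rho^-1 + 1.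
  by move: theta; rewrite !mul1r invfM; lra.
split; first exact: (weighted_silt_exists H1 (ltW rho1) c0 H_rho stableX).
move=> L wL beta b0.
exact: (weighted_silt_exp_moment H1 (ltW rho1) c0 H_rho stableX wL b0).
Qed.
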